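(* Let $H$ be a complex Hilbert space and let $\phi: C_1^+(H)\to C_1^+(H)$ be a bijective map (not assumed to be linear or affine in any sense) which preserves the distance $d_1$, that is, $d_1(\phi(A),\phi(B))=d_1(A,B)$ for all $A,B\in C_1^+(H)$. Then there is an either unitary or antiunitary operator $U$ on $H$ such that $$\phi(A)=UAU^*\qquad (A\in C_1^+(H)).$$
   Context: $H$ is a complex Hilbert space (of arbitrary dimension). $C_1(H)$ denotes the set of all trace-class operators on $H$, i.e. bounded linear operators whose absolute value has finite trace, and $\operatorname{tr}$ is the trace functional. $C_1^+(H)$ is the set of all positive (i.e. positive semidefinite, including $0$) trace-class operators on $H$. The trace-norm of $A\in C_1(H)$ is $\|A\|_1=\operatorname{tr}|A|$, where $|A|$ is the absolute value of $A$, and $d_1(A,B)=\|A-B\|_1$. An antiunitary operator on $H$ is a conjugate-linear bijection $U:H\to H$ with $\langle Ux,Uy\rangle=\overline{\langle x,y\rangle}$ for all $x,y\in H$; its adjoint is $U^*=U^{-1}$ (as for unitary operators). *)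

(* Defs.v *)
From HB Require Import structures.
From mathcomp Require Import all_boot all_order all_algebra.
From mathcomp Require Import sesquilinear complex.
From mathcomp Require Import all_classical all_reals all_analysis.
Set Implicit Arguments.
Unset Strict Implicit.
Unset Printing Implicit Defensive.
Import Order.TTheory GRing.Theory Num.Theory.
Import numFieldNormedType.Exports.
Local Open Scope classical_set_scope.
Local Open Scope ring_scope.
Local Open Scope complex_scope.

(* A complex Hilbert space is a complete normed module
   H over R[i] with an inner product dot : {dot H for Num.conj}, linear in its
   first argument, such that `|x| ^+ 2 = dot x x for all x. The definitions
   do not depend on that last compatibility; theorems have to assume it.
   Operators are plain functions H -> H. *)

Section Operators.
Variables (R : realType) (H : completeNormedModType R[i]).
Variable dot : {dot H for Num.conj}.
Implicit Types (A B P U : H -> H) (E : set H).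

Definition bounded_op A : Prop :=
  linear A /\ exists M : R[i], forall x, `|A x| <= M * `|x|.

Definition is_adjoint A B : Prop := forall x y, dot (A x) y = dot x (B y).

Definition adjoint A : H -> H := xget (fun=> 0) [set B | is_adjoint A B].

(* The order of R[i] only relates numbers with equal imaginary parts, so
   0 <= dot (A x) x also says that dot (A x) x is real. *)
Definition positive_op A : Prop :=
  bounded_op A /\ forall x, 0 <= dot (A x) x.

(* |A|, the unique positive square root of A^* A; it exists for every bounded
   operator on a Hilbert space. *)
Definition absop A : H -> H :=
  xget (fun=> 0) [set P | positive_op P /\ P \o P = adjoint A \o A].

Definition orthonormal_set E : Prop :=
  forall e f, E e -> E f -> dot e f = (e == f)%:R.

Definition orthonormal_basis E : Prop :=
  orthonormal_set E /\ forall x, (forall e, E e -> dot x e = 0) -> x = 0.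

(* Some orthonormal basis of H; one exists by [orthonormal_basis_ex]. *)
Definition hbasis : set H := xget set0 orthonormal_basis.

(* The trace of a positive operator, in [0, +oo]. Its value is the same for
   all orthonormal bases, hence does not depend on the choice in [hbasis]. *)
Definition tr P : \bar R :=
  \esum_(e in hbasis) (complex.Re (dot (P e) e))%:E.

Definition trace_class : set (H -> H) :=
  [set A | bounded_op A /\ (tr (absop A) < +oo)%E].

Definition trace_class_pos : set (H -> H) :=
  [set A | trace_class A /\ positive_op A].

Definition trnorm A : \bar R := tr (absop A).

Definition d1 A B : \bar R := trnorm (A \- B).

Definition unitary U : Prop :=
  [/\ linear U, bijective U & forall x y, dot (U x) (U y) = dot x y].

Definition antiunitary U : Prop :=
  [/\ forall (a : R[i]) x y, U (a *: x + y) = Num.conj a *: U x + U y,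
      bijective U & forall x y, dot (U x) (U y) = Num.conj (dot x y)].

(* U^* for a unitary or antiunitary U, i.e. the inverse map of U; see
   [unitary_adjoint] and [antiunitary_adjoint]. *)
Definition ustar U : H -> H := 'pinv_(fun=> 0) [set: H] U.

Lemma adjointE A B : is_adjoint A B -> adjoint A = B.
Proof.
move=> AB; rewrite /adjoint; case: xgetP => [C _ AC|/(_ B)//].
apply/funext => y; apply/eqP; rewrite -subr_eq0 -(dnorm_eq0 dot); apply/eqP.
by rewrite linearBr /= -AC -AB subrr.
Qed.

Lemma ustarK U : bijective U -> cancel U (ustar U) /\ cancel (ustar U) U.
Proof.
move=> bijU; have injU := bij_inj bijU.
have UK : cancel U (ustar U).
  by move=> x; apply: pinvKV; rewrite ?inE // => y z _ _; apply: injU.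
by split=> //; apply/(bij_can_sym bijU).
Qed.

Lemma unitary_adjoint U : unitary U -> adjoint U = ustar U.
Proof.
move=> [_ /ustarK[_ UK] Uiso]; apply: adjointE => x y.
by rewrite -{1}(UK y) Uiso.
Qed.

Lemma antiunitary_adjoint U x y : antiunitary U ->
  dot (U x) y = Num.conj (dot x (ustar U y)).
Proof. by move=> [_ /ustarK[_ UK] Uiso]; rewrite -{1}(UK y) Uiso. Qed.

Lemma orthonormal_basis_ex : exists E, orthonormal_basis E.
Proof.
have [|E [onE maxE]] := @Zorn_bigcup H orthonormal_set.
  move=> F onF totF e f [X FX Xe] [Y FY Yf].
  have [XY|YX] := totF _ _ FX FY; first by apply: (onF _ FY) => //; exact: XY.
  by apply: (onF _ FX) => //; exact: YX.
exists E; split=> // x xE; apply: contrapT => /eqP x0.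
have dx : 0 < dot x x by rewrite dnorm_gt0.
pose c := sqrtC (dot x x); have c2 : c ^+ 2 = dot x x by rewrite sqrtCK.
have c_gt0 : 0 < c by rewrite sqrtC_gt0.
pose u := c^-1 *: x.
have uu : dot u u = 1.
  rewrite linearZl_LR linearZr_LR /= -c2 conj_Creal ?rpredV ?gtr0_real //.
  by rewrite expr2 !mulrA mulfVK ?mulVf ?gt_eqF.
have uE e : E e -> dot u e = 0.
  by move=> Ee; rewrite linearZl_LR /= xE ?mulr0.
have uNE : ~ E u by move=> /uE /eqP; rewrite uu oner_eq0.
apply: (maxE (E `|` [set u])).
  by split=> [e ? |/(_ u)]; [left|apply: contra_not uNE => h; apply: h; right].
move=> e f [Ee|->] [Ef|->].
- exact: onE.
- rewrite (_ : e == u = false); last by apply/eqP => eu; apply: uNE; rewrite -eu.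
  by rewrite hermC /= expr0 mul1r uE // conjC0.
- rewrite (_ : u == f = false); last by apply/eqP => uf; apply: uNE; rewrite uf.
  exact: uE.
- by rewrite eqxx.
Qed.

Lemma hbasisP : orthonormal_basis hbasis.
Proof.
have [E onE] := orthonormal_basis_ex.
by rewrite /hbasis; case: xgetP => [F //|/(_ E)].
Qed.

End Operators.

(* Main.v *)
Require Import Defs.
From mathcomp Require Import all_boot all_order all_algebra.
From mathcomp Require Import sesquilinear complex.
From mathcomp Require Import all_classical all_reals all_analysis.
From mathcomp Require Import ring lra.

(** Three facts about the trace distance carry the proof. It is computed by the
    Jordan decomposition [A - B = P - T], which minimizes both traces among all
    ways to write [A - B] as a difference of positive trace class operators
    ([trnorm_jordan]); this yields the triangle inequality and homogeneity, and
    it shows that [A <= B] holds exactly when the distance of [A] and [B] is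
    [tr B - tr A] ([tdist_opleP]). Finally, for a unit vector [x],
      d1 A (t |x><x|) = t + tr A - 2 <A x, x> + O(1/t),
    so that the distances of [A] to the multiples of [|x><x|] determine the
    number [<A x, x>] ([tdist_rank1_quad]).

    Let [phi] be a surjective isometry. That a point lies between two others is
    a metric property, and it singles out the origin: if that lies between [B] and
    [E], it lies between every nonnegative multiple of [B] and [E]. This forces
    [phi 0 = 0] ([phi_zero]). Distances to [0] are traces, so [phi] preserves
    the trace and hence the order. The operators of rank at most one are those
    whose order interval is a chain, so [phi] maps [|x><x|] to some
    [|g x><g x|], and [t |x><x|] to [t |g x><g x|] because these are comparable.
    By the asymptotic formula [<phi A (g x), g x> = <A x, x>] for all unit
    vectors [x]. The case [A = |y><y|] says that [g] preserves the moduli of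
    inner products, and Wigner's theorem ([wigner]) replaces [g x] by a multiple
    [U x] with [U] unitary or antiunitary. Then [phi A] and [U A U^-1] have the
    same quadratic form, and so they are equal.

    The analysis behind the first part is kept elementary. Square roots of
    positive operators are strong limits of a monotone iteration
    ([sqrt_exists]). The spectral projection onto the kernel of an operator [T]
    is replaced by the powers of [1 - T^2 / c], which fix the kernel and make [T]
    as small as required on finitely many vectors ([cutoff]). *)

Import Order.TTheory GRing.Theory Num.Theory.
Import numFieldNormedType.Exports.
Local Open Scope classical_set_scope.
Local Open Scope ring_scope.
Local Open Scope complex_scope.

Set Implicit Arguments.
Unset Strict Implicit.
Unset Printing Implicit Defensive.

(** * The real inner product *)

Section Proof.
Variables (R : realType) (H : completeNormedModType R[i]).
Variable dot : {dot H for Num.conj}.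
Hypothesis dot_norm : forall x : H, `|x| ^+ 2 = dot x x.
Implicit Types (x y z v w : H) (u : nat -> H) (A B P S T K D : H -> H).
Implicit Types (a b c r t : R).

Local Notation "r *r x" := (r%:C *: x)
  (at level 40, left associativity, format "r  *r  x").

(** The real part of the inner product determines the inner product
    ([dot_ip]), and a complex linear operator is self-adjoint for one exactly
    when it is for the other. Working with it keeps inequalities in [R]. *)
Definition ip x y : R := complex.Re (dot x y).
Local Notation nsq x := (ip x x).

Lemma dotC x y : dot y x = Num.conj (dot x y).
Proof. by rewrite hermC /= expr0 mul1r. Qed.

Lemma dot_normE x : dot x x = (ip x x)%:C.
Proof.
have := dnorm_ge0 dot x; rewrite /ip lecE /= => /andP[/eqP i0 _].
by case: (dot x x) i0 => a b /= ->.
Qed.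

Lemma ipC x y : ip x y = ip y x.
Proof. by rewrite /ip (dotC y x); case: (dot y x). Qed.

Lemma ipDl x y z : ip (x + y) z = ip x z + ip y z.
Proof. by rewrite /ip linearDl /=; case: (dot x z); case: (dot y z). Qed.

Lemma ipDr x y z : ip x (y + z) = ip x y + ip x z.
Proof. by rewrite ipC ipDl !(ipC x). Qed.

Lemma ipZl r x y : ip (r *r x) y = r * ip x y.
Proof.
by rewrite /ip linearZl_LR /=; case: (dot x y) => a b /=; rewrite mul0r subr0.
Qed.

Lemma ipZr r x y : ip x (r *r y) = r * ip x y.
Proof. by rewrite ipC ipZl ipC. Qed.

Lemma ipNl x y : ip (- x) y = - ip x y.
Proof. by rewrite /ip linearNl /=; case: (dot x y). Qed.

Lemma ipNr x y : ip x (- y) = - ip x y.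
Proof. by rewrite ipC ipNl ipC. Qed.

Lemma ip0l x : ip 0 x = 0.
Proof. by rewrite /ip linear0l. Qed.

Lemma ip0r x : ip x 0 = 0.
Proof. by rewrite ipC ip0l. Qed.

Definition ipE := (ipDl, ipDr, ipNl, ipNr, ipZl, ipZr, ip0l, ip0r).

Lemma ip_ge0 x : 0 <= nsq x.
Proof. by rewrite -ler0c -dot_normE dnorm_ge0. Qed.

Lemma ip_eq0 x : nsq x = 0 -> x = 0.
Proof. by move=> x0; apply/eqP; rewrite -(dnorm_eq0 dot) dot_normE x0. Qed.

Lemma ip_gt0 x : x != 0 -> 0 < nsq x.
Proof.
by move=> x0; rewrite lt_def ip_ge0 andbT; apply: contra_neq x0 => /ip_eq0.
Qed.

Lemma ip_ext x y : (forall z, ip x z = ip y z) -> x = y.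
Proof.
move=> xy; apply/eqP; rewrite -subr_eq0; apply/eqP/ip_eq0.
by rewrite ipDl ipNl xy subrr.
Qed.

Lemma dot_ip x y : dot x y = ip x y +i* ip x ('i *: y).
Proof.
rewrite /ip linearZr_LR /= ; case: (dot x y) => a b /=.
by congr Complex; ring.
Qed.

Lemma ip_ii x y : ip ('i *: x) ('i *: y) = ip x y.
Proof.
rewrite /ip linearZl_LR linearZr_LR /=; case: (dot x y) => a b /=.
by ring.
Qed.

Lemma ip_iC x y : ip x ('i *: y) = - ip ('i *: x) y.
Proof.
rewrite /ip linearZl_LR linearZr_LR /=; case: (dot x y) => a b /=.
by ring.
Qed.

Lemma ip_i0 x : ip x ('i *: x) = 0.
Proof. by have := ip_iC x x; rewrite (ipC x); lra. Qed.

(** The discriminant of a quadratic polynomial without sign change. *)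
Lemma sqr_le_of_quadratic a b c : 0 <= c ->
  (forall t, 0 <= a - 2 * t * b + t ^+ 2 * c) -> b ^+ 2 <= a * c.
Proof.
move=> c0 q; have [{}c0|cE] : 0 < c \/ c = 0 by lra.
  have /(mulr_ge0 (ltW c0)) := q (b / c).
  suff -> : c * (a - 2 * (b / c) * b + (b / c) ^+ 2 * c) =
    a * c - b ^+ 2 by lra.
  by field; lra.
subst c; case: (eqVneq b 0) => [->|b0]; first by lra.
have := q ((a + 1) / (2 * b)); set t := _ / _ => qt.
have tb : t * b * 2 = a + 1 by rewrite /t; field.
by exfalso; lra.
Qed.

Lemma cauchy_schwarz x y : ip x y ^+ 2 <= nsq x * nsq y.
Proof.
apply: sqr_le_of_quadratic => [|t]; first exact: ip_ge0.
have := ip_ge0 (x - t *r y); rewrite !ipE (ipC y x).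
by congr (_ <= _); ring.
Qed.

(** * Convergence of sequences of vectors *)

Lemma nsqD_le x y : nsq (x + y) <= 2 * nsq x + 2 * nsq y.
Proof. by have := ip_ge0 (x - y); rewrite !ipE (ipC y x); lra. Qed.

Lemma normE x : `|x| = (Num.sqrt (nsq x))%:C.
Proof.
have [n0 s0] : 0 <= `|x| /\ 0 <= (Num.sqrt (nsq x))%:C.
  by rewrite ler0c sqrtr_ge0 normr_ge0.
apply: (@pexpIrn _ 2) => //; rewrite dot_norm dot_normE.
by rewrite -rmorphXn /= sqr_sqrtr ?ip_ge0.
Qed.

Definition hlim (u : nat -> H) l : Prop :=
  forall e : R, 0 < e -> exists N, forall n, (N <= n)%N -> nsq (u n - l) <= e.

(** Completeness of the space, for sequences whose increments are dominated by
    those of a bounded monotone real sequence. *)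
Lemma hlim_complete (u : nat -> H) (a : nat -> R) (c M : R) : 0 <= c ->
  (forall m n, (m <= n)%N -> a m <= a n) -> (forall n, a n <= M) ->
  (forall m n, (m <= n)%N -> nsq (u n - u m) <= c * (a n - a m)) ->
  exists l, hlim u l.
Proof.
move=> c0 amono aM ua.
have acvg : cvgn a.
  by apply: nondecreasing_is_cvgn => //; exists M => _ [n _ <-].
have uC : cauchy (u @ \oo).
  apply: cauchy_exP => /= e e0.
  have eE : e = (complex.Re e)%:C.
    by case: e e0 => x y; rewrite ltcE /= => /andP[/eqP -> _].
  have r0 : 0 < complex.Re e by rewrite -ltcR -eE.
  set r := complex.Re e in eE r0.
  have d0 : 0 < r ^+ 2 / (c + 1) / 2 by rewrite !divr_gt0 ?exprn_gt0 //; lra.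
  have /cvgrPdist_le/(_ _ d0)[N _ aN] := acvg.
  exists (u N); exists N => // n /= Nn.
  rewrite -ball_normE /= distrC normE eE ltcR.
  rewrite -(@ltr_pXn2r _ 2) ?nnegrE ?sqrtr_ge0 ?(ltW r0) // sqr_sqrtr ?ip_ge0 //.
  apply: le_lt_trans (ua _ _ Nn) _.
  have h1 := aN _ Nn; have h2 := aN N (leqnn N); rewrite /= in h1 h2.
  have h3 : a n - a N <= r ^+ 2 / (c + 1).
    by move: h1 h2; rewrite !ler_norml; lra.
  have h4 : c * (a n - a N) <= c * (r ^+ 2 / (c + 1)) by exact: ler_wpM2l.
  apply: le_lt_trans h4 _.
  rewrite mulrA ltr_pdivrMr; last by lra.
  by rewrite mulrC ltr_pM2l ?exprn_gt0 //; lra.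
have ul : u @ \oo --> lim (u @ \oo) by exact: cauchy_cvg.
exists (lim (u @ \oo)) => e e0.
have s0 : 0 < (Num.sqrt e)%:C by rewrite ltcR sqrtr_gt0.
have /cvgrPdist_le/(_ _ s0)[N _ uN] := ul.
exists N => n Nn; have := uN _ Nn; rewrite /= distrC normE lecR.
by rewrite ler_sqrt // (ltW e0).
Qed.

Lemma hlim_uniq u l m : hlim u l -> hlim u m -> l = m.
Proof.
move=> ul um; apply/eqP; rewrite -subr_eq0; apply/eqP/ip_eq0.
apply/eqP; rewrite eq_le ip_ge0 andbT; apply/ler_addgt0Pl => e e0;
  rewrite addr0.
have e4 : 0 < e / 4 by lra.
have [N1 h1] := ul _ e4; have [N2 h2] := um _ e4.
have := h1 (N1 + N2)%N (leq_addr _ _); have := h2 (N1 + N2)%N (leq_addl _ _).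
set p := u _ => pm pl.
have -> : l - m = (p - m) - (p - l) by rewrite opprB [RHS]addrC subrKA.
have := nsqD_le (p - m) (- (p - l)).
by rewrite [X in _ + _ * X]ipNl ipNr opprK; lra.
Qed.

Lemma hlim_const l : hlim (fun=> l) l.
Proof. by move=> e e0; exists 0%N => n _; rewrite subrr ip0l ltW. Qed.

Lemma hlimD u (v : nat -> H) l m : hlim u l -> hlim v m ->
  hlim (fun n => u n + v n) (l + m).
Proof.
move=> ul vm e e0; have e4 : 0 < e / 4 by lra.
have [N1 h1] := ul _ e4; have [N2 h2] := vm _ e4.
exists (N1 + N2)%N => n Nn.
have := h1 n (leq_trans (leq_addr _ _) Nn).
have := h2 n (leq_trans (leq_addl _ _) Nn).
have -> : u n + v n - (l + m) = (u n - l) + (v n - m) by rewrite opprD addrACA.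
by have := nsqD_le (u n - l) (v n - m); lra.
Qed.

(** * Self-adjoint and positive operators *)

Definition bnd A c : Prop := 0 <= c /\ forall x, nsq (A x) <= c * nsq x.

Section Linear.
Variables (A : H -> H) (linA : linear A).

Lemma linD x y : A (x + y) = A x + A y.
Proof. by have := linA 1 x y; rewrite !scale1r. Qed.

Lemma lin0 : A 0 = 0.
Proof. by apply: (addrI (A 0)); rewrite -linD !addr0. Qed.

Lemma linZ (k : R[i]) x : A (k *: x) = k *: A x.
Proof. by have := linA k x 0; rewrite lin0 !addr0. Qed.

Lemma linN x : A (- x) = - A x.
Proof. by rewrite -scaleN1r linZ scaleN1r. Qed.

Lemma linB x y : A (x - y) = A x - A y.
Proof. by rewrite linD linN. Qed.

Lemma hlim_lin c u l : bnd A c -> hlim u l -> hlim (fun n => A (u n)) (A l).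
Proof.
move=> [c0 bA] ul e e0; have e1 : 0 < e / (c + 1) by rewrite divr_gt0 //; lra.
have [N h] := ul _ e1; exists N => n Nn; rewrite -linB.
apply: le_trans (bA _) _.
apply: le_trans (ler_wpM2l c0 (h n Nn)) _.
rewrite mulrA ler_pdivrMr; last by lra.
by rewrite mulrC ler_pM2l //; lra.
Qed.
End Linear.

Lemma hlimZ (k : R[i]) u l : hlim u l -> hlim (fun n => k *: u n) (k *: l).
Proof.
have bk : bnd (fun x => k *: x) (complex.Re (k * Num.conj k)).
  split; first by case: k => a b /=; have := sqr_ge0 a; have := sqr_ge0 b; lra.
  move=> x; rewrite /ip linearZl_LR linearZr_LR /= dot_normE.
  by case: k => a b /=; rewrite le_eqVlt; apply/orP; left; apply/eqP; ring.
apply: (hlim_lin (A := fun x => k *: x)) bk => a x y.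
by rewrite scalerDr !scalerA mulrC.
Qed.

Lemma hlim_ip u l y : hlim u l -> ip (u n) y @[n --> \oo] --> ip l y.
Proof.
move=> ul; apply/cvgrPdist_le => e e0 /=.
have y0 := ip_ge0 y; have y1 : 0 < nsq y + 1 by lra.
have d0 : 0 < e ^+ 2 / (nsq y + 1) by rewrite divr_gt0 ?exprn_gt0.
have [N h] := ul _ d0; exists N => // n /= Nn.
rewrite -(@ler_pXn2r _ 2) ?nnegrE ?(ltW e0) // real_normK ?num_real //.
have -> : ip l y - ip (u n) y = - ip (u n - l) y by rewrite ipDl ipNl; ring.
rewrite sqrrN; apply: le_trans (cauchy_schwarz _ _) _.
apply: le_trans (ler_wpM2r y0 (h _ Nn)) _.
by rewrite mulrAC ler_pdivrMr // ler_wpM2l ?sqr_ge0 //; lra.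
Qed.

Lemma hlim_ip_ge0 u l y : hlim u l -> (forall n, 0 <= ip (u n) y) ->
  0 <= ip l y.
Proof.
move=> /hlim_ip-/(_ y) ul u0; rewrite -(cvg_lim _ ul) //.
by apply: limr_ge; [exact: cvgP ul|exact: nearW].
Qed.

Lemma hlim_ip_eq u (v : nat -> H) l m x y : hlim u l -> hlim v m ->
  (forall n, ip (u n) y = ip (v n) x) -> ip l y = ip m x.
Proof.
move=> /hlim_ip-/(_ y) ul /hlim_ip-/(_ x) vm uv.
rewrite -(cvg_lim _ ul) // -(cvg_lim _ vm) //.
by rewrite (_ : (fun n => ip (u n) y) = fun n => ip (v n) x) //; exact/funext.
Qed.

Definition symm A : Prop := forall x y, ip (A x) y = ip x (A y).

Definition selfadj A : Prop := [/\ linear A, symm A & exists c, bnd A c].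

Definition psd A : Prop := selfadj A /\ forall x, 0 <= ip (A x) x.

Lemma selfadj_lin A : selfadj A -> linear A. Proof. by case. Qed.
Lemma selfadj_symm A : selfadj A -> symm A. Proof. by case. Qed.
Lemma psd_selfadj A : psd A -> selfadj A. Proof. by case. Qed.
Lemma psd_lin A : psd A -> linear A. Proof. by case=> -[]. Qed.
Lemma psd_symm A : psd A -> symm A. Proof. by case=> -[]. Qed.
Lemma psd_ge0 A x : psd A -> 0 <= ip (A x) x. Proof. by case. Qed.

Lemma selfadj_ii A x : linear A -> symm A -> ip (A x) ('i *: x) = 0.
Proof.
move=> lA sA; have := ip_iC (A x) x; rewrite -(linZ lA) sA (linZ lA) ipC.
by lra.
Qed.

(** On a complex space a real quadratic form [dot (A x) x] forces [A] to be
    self-adjoint, by polarization along [x - i y]. *)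
Lemma positive_psd A : positive_op dot A <-> psd A.
Proof.
split=> [[[lA [M bA]] pA]|[[lA sA [c [c0 bA]]] pA]]; last first.
  split=> [|x]; last by rewrite dot_ip selfadj_ii // ler0c.
  split=> //; exists (Num.sqrt c)%:C => x.
  by rewrite !normE -rmorphM lecR -sqrtrM // ler_wsqrtr.
have Ai0 x : ip (A x) ('i *: x) = 0.
  by have := pA x; rewrite dot_ip lecE /= => /andP[/eqP].
have sA : symm A.
  move=> x y; have := Ai0 (x + (- 'i) *: y).
  rewrite (linD lA) (linZ lA) scalerDr !scalerA mulrN -expr2 sqr_i opprK scale1r.
  rewrite !ipDl !ipDr Ai0 scaleNr !ipNl ip_ii.
  have -> : ip ('i *: A y) y = 0.
    by rewrite ipC ip_iC ipC Ai0 oppr0.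
  by rewrite (ipC x); lra.
split=> [|x]; last by have := pA x; rewrite dot_ip lecE => /andP[].
split=> //; exists (complex.Re M ^+ 2); split=> [|x]; first exact: sqr_ge0.
have := bA x; rewrite !normE lecE => /andP[_].
have -> : complex.Re (M * (Num.sqrt (nsq x))%:C) =
  complex.Re M * Num.sqrt (nsq x).
  by case: M {bA} => a b /=; ring.
rewrite /= => h; rewrite -(sqr_sqrtr (ip_ge0 (A x))) -[in leRHS](sqr_sqrtr (ip_ge0 x)).
by rewrite -exprMn ler_pXn2r ?nnegrE ?sqrtr_ge0 // (le_trans _ h) ?sqrtr_ge0.
Qed.

Lemma psd_cauchy A x y : psd A -> ip (A x) y ^+ 2 <= ip (A x) x * ip (A y) y.
Proof.
move=> pA; apply: sqr_le_of_quadratic => [|t]; first exact: psd_ge0.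
have := psd_ge0 (x - t *r y) pA;
  rewrite (linB (psd_lin pA)) (linZ (psd_lin pA)).
rewrite !ipE (psd_symm pA y) (ipC y).
by congr (_ <= _); ring.
Qed.

(** Cauchy-Schwarz for the form of [A], applied to [x] and [A x]. *)
Lemma psd_bound A c x : psd A -> (forall y, ip (A y) y <= c * nsq y) ->
  nsq (A x) <= c * ip (A x) x.
Proof.
move=> pA Ac; have := psd_cauchy x (A x) pA.
have a0 := psd_ge0 x pA; have := ler_wpM2l a0 (Ac (A x)).
have [->|n0] := eqVneq (A x) 0; first by rewrite !ipE; lra.
have n1 := ip_gt0 n0 => h1 h2.
rewrite -(ler_pM2r n1) -expr2 (le_trans h2) // (le_trans h1) //.
by rewrite le_eqVlt; apply/orP; left; apply/eqP; ring.
Qed.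

Lemma psd_ker A x : psd A -> ip (A x) x = 0 -> A x = 0.
Proof.
move=> pA x0; apply: ip_eq0; apply/eqP; rewrite -sqrf_eq0 eq_le sqr_ge0 andbT.
by have := psd_cauchy x (A x) pA; rewrite x0 mul0r.
Qed.

Lemma psd_ub A : psd A -> exists2 c, 0 < c & forall x, ip (A x) x <= c * nsq x.
Proof.
move=> [[lA sA [c [c0 bA]]] pA]; exists (c + 1) => [|x]; first by lra.
have := ip_ge0 (A x - x); rewrite !ipE (ipC x); have := bA x.
have := pA x; have := ip_ge0 x; have := mulr_ge0 c0 (ip_ge0 x).
by rewrite mulrDl; lra.
Qed.

Lemma linearD_op A B : linear A -> linear B -> linear (A \+ B).
Proof. by move=> lA lB a x y /=; rewrite lA lB scalerDr addrACA. Qed.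

Lemma linearB_op A B : linear A -> linear B -> linear (A \- B).
Proof.
by move=> lA lB a x y /=; rewrite lA lB scalerBr opprD addrACA.
Qed.

Lemma linearZ_op r A : linear A -> linear (fun x => r *r A x).
Proof. by move=> lA a x y /=; rewrite lA scalerDr !scalerA mulrC. Qed.

Lemma linear_comp A B : linear A -> linear B -> linear (A \o B).
Proof. by move=> lA lB a x y /=; rewrite lB lA. Qed.

Lemma linear_0 : linear ((fun=> 0) : H -> H).
Proof. by move=> a x y; rewrite scaler0 addr0. Qed.

Lemma selfadj0 : selfadj (fun=> 0).
Proof.
split; first exact: linear_0; first by move=> x y; rewrite !ipE.
by exists 0; split=> // x; rewrite !ipE mul0r.
Qed.

Lemma selfadj_id : selfadj id.
Proof. by split=> //; exists 1; split=> // x; rewrite mul1r. Qed.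

Lemma selfadjD A B : selfadj A -> selfadj B -> selfadj (A \+ B).
Proof.
move=> [lA sA [c [c0 bA]]] [lB sB [d [d0 bB]]]; split; first exact: linearD_op.
  by move=> x y /=; rewrite !ipE sA sB.
exists (2 * c + 2 * d); split=> [|x /=]; first by lra.
apply: le_trans (nsqD_le _ _) _.
by have := bA x; have := bB x; lra.
Qed.

Lemma selfadjZ r A : selfadj A -> selfadj (fun x => r *r A x).
Proof.
move=> [lA sA [c [c0 bA]]]; split; first exact: linearZ_op.
  by move=> x y /=; rewrite !ipE sA.
exists (r ^+ 2 * c); split=> [|x /=]; first by rewrite mulr_ge0 ?sqr_ge0.
by rewrite !ipE mulrA -expr2 -mulrA ler_wpM2l ?sqr_ge0.
Qed.

Lemma selfadjB A B : selfadj A -> selfadj B -> selfadj (A \- B).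
Proof.
move=> sA sB; have -> : A \- B = A \+ (fun x => (-1) *r B x).
  by apply/funext => x /=; rewrite rmorphN1 scaleN1r.
exact/selfadjD/selfadjZ.
Qed.

Lemma selfadj_comp A B : selfadj A -> selfadj B ->
  (forall x, A (B x) = B (A x)) -> selfadj (A \o B).
Proof.
move=> [lA sA [c [c0 bA]]] [lB sB [d [d0 bB]]] AB; split.
- exact: linear_comp.
- by move=> x y /=; rewrite sA sB AB.
- exists (c * d); split=> [|x /=]; first exact: mulr_ge0.
  by apply: le_trans (bA _) _; rewrite -mulrA ler_wpM2l.
Qed.

Lemma psd0 : psd (fun=> 0).
Proof. by split=> [|x]; [exact: selfadj0|rewrite ipE]. Qed.

Lemma psdD A B : psd A -> psd B -> psd (A \+ B).
Proof.
move=> [sA pA] [sB pB]; split=> [|x /=]; first exact: selfadjD.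
by rewrite ipE addr_ge0.
Qed.

Lemma psdZ r A : 0 <= r -> psd A -> psd (fun x => r *r A x).
Proof.
move=> r0 [sA pA]; split=> [|x /=]; first exact: selfadjZ.
by rewrite ipE mulr_ge0.
Qed.

(** * Square roots of positive operators *)

(** Polynomials in [X] with nonnegative coefficients. They commute with
    everything that commutes with [X], and are positive when [X] is. *)
Inductive npol (X : H -> H) : (H -> H) -> Prop :=
| npol0 : npol X (fun=> 0)
| npol1 : npol X id
| npolX T : npol X T -> npol X (X \o T)
| npolD T S : npol X T -> npol X S -> npol X (T \+ S)
| npolZ r T : 0 <= r -> npol X T -> npol X (fun x => r *r T x).

Lemma npol_comp X T S : npol X T -> npol X S -> npol X (T \o S).
Proof.
move=> + pS; elim=> [|//|T1 _ pT1|T1 T2 _ p1 _ p2|r T1 r0 _ p1].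
- exact: npol0.
- exact: (@npolX X (T1 \o S)).
- exact: (@npolD X (T1 \o S) (T2 \o S)).
- exact: (@npolZ X r (T1 \o S)).
Qed.

Lemma npol_comm X T B : linear B -> (forall x, B (X x) = X (B x)) ->
  npol X T -> forall x, B (T x) = T (B x).
Proof.
move=> lB BX; elim=> [x|//|T1 _ p1 x|T1 T2 _ p1 _ p2 x|r T1 r0 _ p1 x] /=.
- exact: lin0.
- by rewrite BX p1.
- by rewrite (linD lB) p1 p2.
- by rewrite (linZ lB) p1.
Qed.

Lemma npol_selfadj X T : selfadj X -> npol X T -> selfadj T.
Proof.
move=> sX; elim=> [||T1 n1 p1|T1 T2 _ p1 _ p2|r T1 r0 _ p1].
- exact: selfadj0.
- exact: selfadj_id.
- by apply: selfadj_comp => // x; rewrite (npol_comm (selfadj_lin sX) _ n1).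
- exact: selfadjD.
- exact: selfadjZ.
Qed.

(** The form of [X^k] is nonnegative because [X^(2j)] is a square and
    [X^(2j+1)] is [X] compressed by [X^j]; the claim is proved for all [X^k T]
    so that induction passes through the composition with [X]. *)
Lemma npol_psd X T : psd X -> npol X T -> psd T.
Proof.
move=> pX pT; split; first exact: npol_selfadj (psd_selfadj pX) pT.
have lX k : linear (iter k X).
  elim: k => [|k IH] //; exact: (linear_comp (psd_lin pX) IH).
suff h k x : 0 <= ip (iter k X (T x)) x by move=> x; exact: (h 0%N).
elim: pT k x => [k x|k x|T1 n1 p1 k x|T1 T2 n1 p1 n2 p2 k x|r T1 r0 n1 p1 k x] /=.
- by rewrite (lin0 (lX k)) ipE.
- elim/ltn_ind: k x => -[|[|k]] IH x /=; [exact: ip_ge0|exact: psd_ge0|].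
  by rewrite -iterS iterSr /= (psd_symm pX); exact: IH.
- by rewrite -iterSr; exact: p1.
- by rewrite (linD (lX k)) ipE addr_ge0.
- by rewrite (linZ (lX k)) ipE mulr_ge0.
Qed.

(** [Y' = (X + Y^2) / 2] increases to the solution of [Y = (X + Y^2) / 2], for
    which [(1 - Y)^2 = 1 - X]. *)
Fixpoint sqrt_iter (X : H -> H) n : H -> H :=
  if n is m.+1 then fun x => 2^-1 *r (X x + sqrt_iter X m (sqrt_iter X m x))
  else fun=> 0.

Lemma sqrt_iter_npol X n : npol X (sqrt_iter X n).
Proof.
elim: n => [|n IH]; first exact: npol0.
apply: (@npolZ X 2^-1 (X \+ (sqrt_iter X n \o sqrt_iter X n))); first by lra.
apply: npolD; first exact: (@npolX X id (npol1 X)).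
exact: npol_comp.
Qed.

(** The increments satisfy [Y'' - Y' = (Y (Y' - Y) + (Y' - Y) Y') / 2], which
    is again a polynomial with nonnegative coefficients. *)
Lemma sqrt_iter_mono X m n : linear X -> (m <= n)%N ->
  exists2 T, npol X T & sqrt_iter X n = sqrt_iter X m \+ T.
Proof.
move=> lX; have lY k : linear (sqrt_iter X k).
  elim: k => [|k IH]; first exact: linear_0.
  exact: linearZ_op (linearD_op lX (linear_comp IH IH)).
have st k : exists2 T, npol X T & sqrt_iter X k.+1 = sqrt_iter X k \+ T.
  elim: k => [|k [T nT YT]].
    exists (fun x => 2^-1 *r X x).
      by apply: npolZ; [lra|exact: (@npolX X id (npol1 X))].
    by apply/funext => x /=; rewrite addr0 add0r.
  exists (fun x => 2^-1 *r (sqrt_iter X k (T x) + T (sqrt_iter X k.+1 x))).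
    apply: (@npolZ X _ ((sqrt_iter X k \o T) \+ (T \o sqrt_iter X k.+1))).
      by lra.
    by apply: npolD; apply: npol_comp => //; exact: sqrt_iter_npol.
  have YTx x : sqrt_iter X k.+1 x = sqrt_iter X k x + T x by rewrite YT.
  apply/funext => x.
  change (2^-1 *r (X x + sqrt_iter X k.+1 (sqrt_iter X k.+1 x)) =
    2^-1 *r (X x + sqrt_iter X k (sqrt_iter X k x)) +
    2^-1 *r (sqrt_iter X k (T x) + T (sqrt_iter X k.+1 x))).
  rewrite -scalerDr -addrA; congr (_ *: (_ + _)).
  by rewrite {1}YTx {1}YTx (linD (lY k)) addrA.
have Ymm : exists2 T, npol X T & sqrt_iter X m = sqrt_iter X m \+ T.
  by exists (fun=> 0); [exact: npol0|apply/funext => x /=; rewrite addr0].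
elim: n => [|n IH]; first by rewrite leqn0 => /eqP m0; move: Ymm; rewrite m0.
rewrite leq_eqVlt => /orP[/eqP <- //|/IH[T nT YT]].
have [S nS ->] := st n; exists (T \+ S); first exact: npolD.
by apply/funext => x; rewrite YT /= addrA.
Qed.

Lemma hlim_comp (Y : nat -> H -> H) L x c : (forall n, linear (Y n)) ->
  (forall n, bnd (Y n) c) -> (forall x, hlim (Y^~ x) (L x)) ->
  hlim (fun n => Y n (Y n x)) (L (L x)).
Proof.
move=> lY bY YL.
have e : (fun n => Y n (Y n x)) = (fun n => Y n (Y n x - L x) + Y n (L x)).
  by apply/funext => n; rewrite (linB (lY n)) subrK.
rewrite e -[L (L x)]add0r; apply: hlimD; last exact: YL.
move=> d d0; have [c0 _] := bY 0%N.
have d1 : 0 < d / (c + 1) by rewrite divr_gt0 //; lra.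
have [N h] := YL x _ d1; exists N => n Nn; rewrite subr0.
have [_ /(_ (Y n x - L x)) /le_trans ->//] := bY n.
apply: le_trans (ler_wpM2l c0 (h n Nn)) _.
rewrite mulrA ler_pdivrMr; last by lra.
by rewrite mulrC ler_pM2l //; lra.
Qed.

Lemma psd_contraction A x : psd A -> (forall y, ip (A y) y <= nsq y) ->
  nsq (A x) <= nsq x.
Proof.
move=> pA A1; have := @psd_bound A 1 x pA; rewrite mul1r.
by move=> /(_ (fun y => ltac:(rewrite mul1r; exact: A1)))/le_trans -> //.
Qed.

(** The iteration converges strongly for [X = 1 - A]: its increments are
    positive contractions, so their squared norms are bounded by the increments
    of the bounded monotone numbers [ip (Y n x) x]. *)
Lemma sqrt_exists1 A : psd A -> (forall x, ip (A x) x <= nsq x) ->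
  exists S, [/\ psd S, forall x, S (S x) = A x &
    forall B c, linear B -> bnd B c -> (forall x, B (A x) = A (B x)) ->
      forall x, B (S x) = S (B x)].
Proof.
move=> pA A1; pose X x := x - A x; pose Y := sqrt_iter X.
have pX : psd X.
  split=> [|x]; first exact: selfadjB selfadj_id (psd_selfadj pA).
  by rewrite !ipE subr_ge0.
have X1 x : nsq (X x) <= nsq x.
  apply: psd_contraction => // y; rewrite !ipE.
  by have := psd_ge0 y pA; lra.
have pY n : psd (Y n) by exact: npol_psd pX (sqrt_iter_npol X n).
have Y1 n x : nsq (Y n x) <= nsq x.
  elim: n x => [|n IH] x; first by rewrite /= ip0l ip_ge0.
  rewrite /Y /= -/(Y n) !ipZl !ipZr.
  have := nsqD_le (X x) (Y n (Y n x)); have := X1 x.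
  by have := le_trans (IH (Y n x)) (IH x); lra.
have bY n : bnd (Y n) 1 by split=> // x; rewrite mul1r.
have YL x : exists l, hlim (Y^~ x) l.
  apply: (@hlim_complete _ (fun n => ip (Y n x) x) 1 (nsq x)) => //.
  - move=> m n mn; have [T nT] := sqrt_iter_mono (psd_lin pX) mn.
    by rewrite -/(Y _) -/(Y _) => -> /=; rewrite ipDl lerDl;
      have /psd_ge0 := npol_psd pX nT.
  - move=> n; have := ip_ge0 (Y n x - x); have := Y1 n x.
    by rewrite !ipE (ipC x); lra.
  - move=> m n mn; have [T nT YT] := sqrt_iter_mono (psd_lin pX) mn.
    have pT := npol_psd pX nT.
    rewrite -/(Y _) -/(Y _) in YT.
    have -> : Y n x - Y m x = T x by rewrite YT /= addrC addKr.
    have -> : ip (Y n x) x - ip (Y m x) x = ip (T x) x by rewrite YT ipDl; ring.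
    apply: psd_bound => // y; rewrite mul1r.
    have := ip_ge0 (Y n y - y); have := Y1 n y; have := psd_ge0 y (pY m).
    by rewrite YT /= !ipE (ipC y); rewrite ?(ipC y (T y)); lra.
have /choice[L hL] := YL.
have lL : linear L.
  move=> a x y; apply: hlim_uniq (hL _) _.
  have -> : Y^~ (a *: x + y) = fun n => a *: Y n x + Y n y.
    by apply/funext => n; rewrite (psd_lin (pY n)).
  by apply: hlimD => //; exact: hlimZ.
have sL : symm L.
  move=> x y; rewrite (ipC x); apply: hlim_ip_eq (hL x) (hL y) _ => n.
  by rewrite (psd_symm (pY n)) ipC.
have L1 x : ip (L x) x <= nsq x.
  rewrite -subr_ge0.
  have := @hlim_ip_ge0 (fun n => x + (-1) *: Y n x) (x + (-1) *: L x) x.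
  rewrite scaleN1r ipDl ipNl; apply.
    by rewrite -[- L x]scaleN1r; apply: hlimD; [exact: hlim_const|exact: hlimZ].
  move=> n; rewrite scaleN1r !ipE.
  by have := ip_ge0 (Y n x - x); have := Y1 n x; rewrite !ipE (ipC x); lra.
have L0 x : 0 <= ip (L x) x.
  by apply: hlim_ip_ge0 (hL x) _ => n; exact: psd_ge0.
have L2 x : nsq (L x) <= 2 * nsq x.
  apply/ler_addgt0Pl => e e0; have e2 : 0 < e / 2 by lra.
  have [N /(_ N (leqnn _))] := hL x _ e2.
  have := nsqD_le (Y N x) (L x - Y N x); rewrite addrC subrK.
  by have := Y1 N x; rewrite !ipE; lra.
have LE x : L x = 2^-1 *r (X x + L (L x)).
  have h : hlim (fun n => Y n.+1 x) (L x).
    by move=> e /(hL x)[N hN]; exists N => n Nn; apply: hN; exact: leqW.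
  apply: hlim_uniq h _; apply: hlimZ; apply: hlimD; first exact: hlim_const.
  by apply: hlim_comp hL => n; [exact: psd_lin|exact: bY].
exists (fun x => x - L x); split.
- split=> [|x]; last by rewrite !ipE subr_ge0.
  by apply: selfadjB selfadj_id _; split=> //; exists 2; split.
- move=> x; apply: ip_ext => z; have := congr1 (ip^~ z) (LE x).
  by rewrite (linB lL) /X !ipE; lra.
- move=> B c lB bB BA x; rewrite (linB lB); congr (_ - _).
  apply: hlim_uniq (hL _); have := hlim_lin lB bB (hL x).
  congr hlim; apply/funext => n.
  apply: (npol_comm lB _ (sqrt_iter_npol X n)) => y.
  by rewrite /X (linB lB) BA.
Qed.

Lemma sqrt_exists A : psd A ->
  exists S, [/\ psd S, forall x, S (S x) = A x &
    forall B c, linear B -> bnd B c -> (forall x, B (A x) = A (B x)) ->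
      forall x, B (S x) = S (B x)].
Proof.
move=> pA; have [c c0 Ac] := psd_ub pA.
have [||S [pS SS SB]] := @sqrt_exists1 (fun x => c^-1 *r A x).
- by apply: psdZ => //; rewrite invr_ge0 ltW.
- by move=> x; rewrite ipE mulrC ler_pdivrMr // mulrC.
exists (fun x => Num.sqrt c *r S x); split.
- by apply: psdZ => //; exact: sqrtr_ge0.
- move=> x; rewrite (linZ (psd_lin pS)) SS !scalerA -!rmorphM /=.
  by rewrite mulrA -expr2 sqr_sqrtr ?(ltW c0) // divff ?gt_eqF // scale1r.
- move=> B d lB bB BA x; rewrite (linZ lB); congr (_ *: _).
  by apply: (SB _ d) => // y; rewrite (linZ lB) BA.
Qed.

(** If [P] and [S] are positive with equal squares and commute, then
    [(P - S) (P + S) (P - S) = 0] is a sum of two positive operators, both of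
    which vanish. *)
Lemma sqrt_unique P S : psd P -> psd S -> (forall x, P (P x) = S (S x)) ->
  (forall x, P (S x) = S (P x)) -> P = S.
Proof.
move=> pP pS PS comm; apply/funext => x; apply/eqP; rewrite -subr_eq0;
  apply/eqP.
set T := fun y => P y - S y.
have [lP lS] := (psd_lin pP, psd_lin pS).
have sT : selfadj T by exact: selfadjB (psd_selfadj pP) (psd_selfadj pS).
have PT y : P (T y) + S (T y) = 0.
  by rewrite (linB lP) (linB lS) PS comm addrA subrK subrr.
have T0 y : P (T y) = 0 /\ S (T y) = 0.
  have := congr1 (ip^~ (T y)) (PT y); rewrite ipDl ip0l => e.
  have := psd_ge0 (T y) pP; have := psd_ge0 (T y) pS => h1 h2.
  by split; apply: psd_ker => //; lra.
apply: ip_eq0; rewrite -/(T x) (selfadj_symm sT).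
by have [h1 h2] := T0 x; rewrite {1}/T h1 h2 subr0 ip0r.
Qed.

(** * The Jordan decomposition *)

Lemma adjoint_selfadj A : selfadj A -> adjoint dot A = A.
Proof.
move=> [lA sA _]; apply: adjointE => x y.
by rewrite !dot_ip -(linZ lA) !sA.
Qed.

(** Every positive square root of [D^2] commutes with [D^2], hence with the root
    built by [sqrt_exists], and so coincides with it. *)
Lemma absop_eq D S : selfadj D -> psd S -> (forall x, S (S x) = D (D x)) ->
  absop dot D = S.
Proof.
move=> sD pS SD; rewrite /absop adjoint_selfadj //.
have pDD : psd (D \o D).
  by split=> [|x /=]; [exact: selfadj_comp|rewrite (selfadj_symm sD) ip_ge0].
have [S0 [pS0 SS0 comm]] := sqrt_exists pDD.
have uniq P : psd P -> (forall x, P (P x) = D (D x)) -> P = S0.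
  move=> pP PD; apply: sqrt_unique => //; first by move=> x; rewrite PD SS0.
  have [_ _ [c bP]] := psd_selfadj pP; have lP := psd_lin pP.
  by apply: comm bP _ => // x /=; rewrite -!PD.
rewrite (uniq S) //; case: xgetP => [P _ [/positive_psd pP PD]|].
  by apply: uniq => // x; have := congr1 (fun g => g x) PD.
by move=> /(_ S0) []; split; [exact/positive_psd|apply/funext].
Qed.

Lemma absop_psd A : psd A -> absop dot A = A.
Proof. by move=> pA; apply: absop_eq => //; exact: psd_selfadj. Qed.

(** Otherwise the sequence decreases by at least [d] at every step. *)
Lemma sum_arch (a : nat -> R) (d : R) : 0 < d -> (forall n, 0 <= a n) ->
  exists n, a n - d <= a n.+1.
Proof.
move=> d0 a0; apply: contrapT => /forallNP an.
have ub n : a n <= a 0%N - d *+ n.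
  elim: n => [|n IH]; first by rewrite mulr0n subr0.
  by have /negP := an n; rewrite -ltNge mulrS; lra.
have := ub (Num.bound (a 0%N / d)); have := a0 (Num.bound (a 0%N / d)).
have := archi_boundP (divr_ge0 (a0 0%N) (ltW d0)).
by rewrite ltr_pdivrMr // -mulr_natl mulrC; lra.
Qed.

(** [K] is a power of [C = 1 - T^2 / c] with [c] at least [|T|^2]. As
    [|C y|^2 <= |y|^2 - |T y|^2 / c], the sum of the [|C^k x|^2] over [s]
    decreases by a multiple of the sum of the [|T C^k x|^2], so that the latter
    is small for some [k]. *)
Lemma cutoff T (s : seq H) (e : R) : selfadj T -> 0 < e -> exists K,
  [/\ selfadj K, forall x, nsq (K x) <= nsq x, forall y, T y = 0 -> K y = y &
    forall x, x \in s -> nsq (T (K x)) <= e].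
Proof.
move=> sT e0; have [lT syT [c' [c'0 bT']]] := sT.
have [c c0 bT] : exists2 c, 0 < c & forall x, nsq (T x) <= c * nsq x.
  exists (c' + 1) => [|x]; first by lra.
  by have := bT' x; have := ip_ge0 x; rewrite mulrDl; lra.
pose C x := x - c^-1 *r T (T x).
have sC : selfadj C by apply: selfadjB selfadj_id _;
  apply/selfadjZ/selfadj_comp.
have lC := selfadj_lin sC.
have CT y : nsq (C y) <= nsq y - c^-1 * nsq (T y).
  have h : c^-1 * nsq (T (T y)) <= nsq (T y).
    by rewrite mulrC ler_pdivrMr // mulrC.
  have ci : 0 <= c^-1 by rewrite invr_ge0 ltW.
  have := ler_wpM2l ci h; rewrite /C !ipE.
  by rewrite (syT (T y) y) (ipC y) (syT (T y) y); lra.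
have C1 y : nsq (C y) <= nsq y.
  apply: le_trans (CT y) _; rewrite gerBl mulr_ge0 ?ip_ge0 //.
  by rewrite invr_ge0 ltW.
pose K k := iter k C.
have sK k : selfadj (K k).
  elim: k => [|k IH]; first exact: selfadj_id.
  by apply: (selfadj_comp sC IH) => x; rewrite -iterS iterSr.
pose a k := \sum_(x <- s) nsq (K k x).
have [k ak] : exists k, a k - e / c <= a k.+1.
  by apply: sum_arch => [|k]; [rewrite divr_gt0|rewrite sumr_ge0 // => x _;
    exact: ip_ge0].
exists (K k); split=> //.
- by move=> x; elim: (k) => [|j IH] //=; apply: le_trans (C1 _) IH.
- move=> y Ty; elim: (k) => [|j IH] //=; rewrite IH /C Ty lin0 //.
  by rewrite scaler0 subr0.
- move=> x xs.
  have : \sum_(y <- s) nsq (T (K k y)) <= e.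
    have : a k.+1 <= a k - c^-1 * \sum_(y <- s) nsq (T (K k y)).
      rewrite mulr_sumr -sumrB; apply: ler_sum => y _; exact: CT.
    move=> h; have : c^-1 * \sum_(y <- s) nsq (T (K k y)) <= c^-1 * e by lra.
    by rewrite ler_pM2l ?invr_gt0.
  apply: le_trans; rewrite (big_rem _ xs) /= lerDl sumr_ge0 // => y _.
  exact: ip_ge0.
Qed.

Lemma ip_small x y (e : R) : 0 < e -> nsq x <= e ^+ 2 ->
  ip x y <= e * (1 + nsq y).
Proof.
move=> e0 xe; have := ip_ge0 (x - e *r y); rewrite !ipE (ipC y) => h.
rewrite -(ler_pM2l e0); have :=
  mulr_ge0 (mulr_ge0 (ltW e0) (ltW e0)) (ip_ge0 y).
by have := sqr_ge0 e; lra.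
Qed.

Lemma cutoff_ip P K x : selfadj P -> selfadj K -> (forall y, K (P y) = P y) ->
  ip (P (K x)) (K x) = ip (P x) x.
Proof.
by move=> /selfadj_symm sP /selfadj_symm sK KP; rewrite -sK KP sP sK KP ipC.
Qed.

(** [P + T] is positive and, compressed by a [K] as in [cutoff], close to
    [P]. *)
Lemma orth_psd P T : selfadj P -> selfadj T -> (forall x, T (P x) = 0) ->
  (forall x, 0 <= ip (P x + T x) x) -> psd P.
Proof.
move=> sP sT TP PT; split=> // x; rewrite leNgt; apply/negP => Px.
have x0 := ip_ge0 x.
pose e := - ip (P x) x / (1 + nsq x) / 2.
have e0 : 0 < e by rewrite !divr_gt0 //; lra.
have [K [sK K1 Kker /(_ x (mem_head _ _)) Ke]] :=
  cutoff [:: x] sT (exprn_gt0 2 e0).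
have KP y : K (P y) = P y by apply: Kker.
have := PT (K x); rewrite ipDl (cutoff_ip x sP sK KP).
have := ip_small (K x) e0 Ke; have := ler_wpM2l (ltW e0) (K1 x).
suff : e * (1 + nsq x) = - ip (P x) x / 2 by lra.
by rewrite /e; field; lra.
Qed.

(** [P] and [T] are the halves of [|D| + D] and [|D| - D]. Their product is zero
    because [|D|] commutes with [D] and has the same square, and their sum [|D|]
    is positive. *)
Lemma jordan D : selfadj D -> exists P T,
  [/\ psd P, psd T, forall x, D x = P x - T x,
  forall x, absop dot D x = P x + T x & forall x, P (T x) = 0 /\ T (P x) = 0].
Proof.
move=> sD; have lD := selfadj_lin sD.
have pDD : psd (D \o D).
  by split=> [|x /=]; [exact: selfadj_comp|rewrite (selfadj_symm sD) ip_ge0].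
have [S [pS SS comm]] := sqrt_exists pDD.
have lS := psd_lin pS.
have DS x : D (S x) = S (D x).
  by have [_ _ [c bD]] := sD; apply: comm bD _ x.
pose P x := 2^-1 *r (S x + D x); pose T x := 2^-1 *r (S x - D x).
have sP : selfadj P by apply/selfadjZ/selfadjD/sD/psd_selfadj.
have sT : selfadj T by apply/selfadjZ/selfadjB/sD/psd_selfadj.
have PT x : P (T x) = 0.
  rewrite /P /T !(linZ lS) !(linZ lD) (linB lS) (linB lD) SS DS /=.
  by rewrite -scalerDr addrA subrK subrr !scaler0.
have TP x : T (P x) = 0.
  rewrite /P /T !(linZ lS) !(linZ lD) (linD lS) (linD lD) SS DS /=.
  by rewrite -scalerBr [X in _ - X]addrC subrr !scaler0.
have sum x : P x + T x = S x.
  by apply: ip_ext => z; rewrite /P /T !ipE; lra.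
exists P, T; split.
- by apply: orth_psd sT _ _ => // x; rewrite sum; exact: psd_ge0.
- by apply: orth_psd sP _ _ => // x; rewrite addrC sum; exact: psd_ge0.
- by move=> x; apply: ip_ext => z; rewrite /P /T !ipE; lra.
- by move=> x; rewrite sum (absop_eq sD pS).
- by move=> x; split.
Qed.

(** Compressing [P = A - B + T] by [K] as in [cutoff] fixes [P], drops the
    negative term [- B], and makes [T] negligible. *)
Lemma jordan_cutoff A B P T (s : seq H) (e : R) : psd B -> psd P -> psd T ->
  (forall x, A x - B x = P x - T x) -> (forall x, T (P x) = 0) -> 0 < e ->
  exists K, [/\ selfadj K, forall x, nsq (K x) <= nsq x &
    \sum_(x <- s) ip (P x) x <= \sum_(x <- s) ip (A (K x)) (K x) + e].
Proof.
move=> pB pP pT ABPT TP e0.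
pose M := \sum_(x <- s) (1 + nsq x).
have M0 : 0 <= M by apply: sumr_ge0 => x _; rewrite addr_ge0 ?ip_ge0.
pose d := e / (1 + M).
have d0 : 0 < d by rewrite divr_gt0 //; lra.
have [K [sK K1 Kker Kd]] := cutoff s (psd_selfadj pT) (exprn_gt0 2 d0).
exists K; split=> //.
have KP y : K (P y) = P y by apply: Kker.
apply: (@le_trans _ _ (\sum_(x <- s) (ip (A (K x)) (K x) + d * (1 + nsq x)))).
  rewrite big_seq [leRHS]big_seq; apply: ler_sum => x xs.
  rewrite -(cutoff_ip x (psd_selfadj pP) sK KP).
  have := congr1 (ip^~ (K x)) (ABPT (K x)); rewrite !ipE.
  have := psd_ge0 (K x) pB; have := ip_small (K x) d0 (Kd x xs).
  by have := ler_wpM2l (ltW d0) (K1 x); lra.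
rewrite big_split -mulr_sumr /= -/M lerD2l /d mulrAC ler_pdivrMr; last by lra.
by rewrite ler_pM2l //; lra.
Qed.

(** * Parseval's identity *)

Lemma esum_le_fin (E : set H) (F : H -> R) (M : \bar R) :
  (forall s, uniq s -> (forall x, x \in s -> E x) ->
    ((\sum_(x <- s) F x)%:E <= M)%E) ->
  (\esum_(x in E) (F x)%:E <= M)%E.
Proof.
move=> h; apply: ge_ereal_sup => _ [X [finX XE] <-].
rewrite fsbig_finite // sumEFin; apply: h; first exact: finmap.fset_uniq.
by move=> x; rewrite in_fset_set // inE => /XE.
Qed.

Lemma esum_ge_fin (E : set H) (F : H -> R) s : uniq s ->
  (forall x, x \in s -> E x) ->
  ((\sum_(x <- s) F x)%:E <= \esum_(x in E) (F x)%:E)%E.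
Proof.
move=> us sE; apply: esum_ge; exists [set` s]; first by split;
  [exact: finite_seq|exact: sE].
by rewrite -fsbig_seq // sumEFin.
Qed.

(** This is [|dot x y|^2], see [dot2E]. *)
Definition dot2 x y : R := ip x y ^+ 2 + ip x ('i *: y) ^+ 2.

Lemma dot2_ge0 x y : 0 <= dot2 x y.
Proof. by rewrite addr_ge0 ?sqr_ge0. Qed.

Lemma dot2C x y : dot2 x y = dot2 y x.
Proof. by rewrite /dot2 ip_iC (ipC ('i *: x)) sqrrN (ipC x). Qed.

Lemma dot2E x y : dot2 x y =
  complex.Re (dot x y) ^+ 2 + complex.Im (dot x y) ^+ 2.
Proof. by rewrite (dot_ip x y). Qed.

Lemma dot2_eq0 x y : dot2 x y = 0 -> dot x y = 0.
Proof.
rewrite dot2E; case: (dot x y) => a b /= /eqP.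
by rewrite paddr_eq0 ?sqr_ge0 // !sqrf_eq0 => /andP[/eqP -> /eqP ->].
Qed.

(** Cauchy-Schwarz for the real inner product of [x] and the multiple of [y]
    whose inner product with [x] is the real number [|dot x y|^2]. *)
Lemma dot2_le x y : dot2 x y <= nsq x * nsq y.
Proof.
pose z := dot x y *: y.
have e1 : ip x z = dot2 x y.
  by rewrite dot2E /z /ip linearZr_LR /=; case: (dot x y) => a b /=; ring.
have e2 : nsq z = dot2 x y * nsq y.
  rewrite dot2E /z {1}/ip linearZr_LR linearZl_LR /= dot_normE.
  by case: (dot x y) => a b /=; ring.
have := cauchy_schwarz x z; rewrite e1 e2.
have [->|n0] := eqVneq (dot2 x y) 0; first by rewrite mulr_ge0 ?ip_ge0.
have d0 : 0 < dot2 x y by rewrite lt_def n0 dot2_ge0.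
by rewrite expr2 mulrCA ler_pM2l.
Qed.

(** The recursion makes repetitions in [s] harmless: a component that is already
    zero is removed once more. *)
Fixpoint residue (s : seq H) v : H :=
  if s is f :: s' then residue s' v - dot (residue s' v) f *: f else v.

Section Residue.
Variable E : set H.
Hypothesis onE : orthonormal_set dot E.

Lemma nsq_sub_unit w f : E f -> nsq (w - dot w f *: f) = nsq w - dot2 w f.
Proof.
move=> Ef; rewrite /ip linearBl !linearBr /= !linearZl_LR !linearZr_LR /=.
rewrite (onE Ef Ef) eqxx /= dot2E (dotC w f) dot_normE /GRing.scale.
by case: (dot w f) => a b /=; ring.
Qed.

Lemma dot_residue s v f : (forall x, x \in s -> E x) -> E f ->
  dot (residue s v) f = if f \in s then 0 else dot v f.
Proof.
elim: s => [|g s IH] sE Ef //=.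
have {}IH := IH (fun x xs => sE x (mem_behead (s := g :: s) xs)) Ef.
have Eg : E g by apply: sE; exact: mem_head.
rewrite linearBl /= linearZl_LR /= (onE Eg Ef) inE eq_sym.
case: eqVneq => [<-|fg] /=; first by rewrite mulr1 subrr.
by rewrite mulr0 subr0.
Qed.

Lemma nsq_residue s v : uniq s -> (forall x, x \in s -> E x) ->
  nsq (residue s v) = nsq v - \sum_(f <- s) dot2 v f.
Proof.
elim: s => [|f s IH] /=; first by rewrite big_nil subr0.
move=> /andP[fs us] sE.
have sE' x : x \in s -> E x by move=> xs; apply: sE; rewrite inE xs orbT.
have Ef : E f by apply: sE; exact: mem_head.
rewrite nsq_sub_unit // IH // big_cons.
have -> : dot2 (residue s v) f = dot2 v f.
  by rewrite !dot2E dot_residue // (negbTE fs).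
by ring.
Qed.

Lemma bessel s v : uniq s -> (forall x, x \in s -> E x) ->
  \sum_(f <- s) dot2 v f <= nsq v.
Proof.
by move=> us sE; have := ip_ge0 (residue s v); rewrite nsq_residue //; lra.
Qed.

Lemma ip_residue s v w : (forall f, f \in s -> dot f w = 0) ->
  ip (residue s v) w = ip v w.
Proof.
elim: s => [|g s IH] sw //=.
rewrite ipDl ipNl IH; last by move=> f fs; apply: sw; rewrite inE fs orbT.
by rewrite {2}/ip linearZl_LR /= (sw g) ?mem_head // mulr0 subr0.
Qed.

Lemma residue_incr s s' v : (forall x, x \in s' -> E x) ->
  (forall x, x \in s -> x \in s') ->
  nsq (residue s v - residue s' v) = nsq (residue s v) - nsq (residue s' v).
Proof.
move=> s'E ss'.
have orth f : f \in s' -> dot f (residue s' v) = 0.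
  by move=> fs'; rewrite dotC dot_residue ?fs' ?conjC0 //; exact: s'E.
have e1 : ip (residue s v) (residue s' v) = ip v (residue s' v).
  by apply: ip_residue => f /ss'; exact: orth.
have e2 : nsq (residue s' v) = ip v (residue s' v) by exact: ip_residue.
by rewrite !ipE (ipC (residue s' v) (residue s v)) e1 e2; ring.
Qed.

(** Completeness of the space enters here: the residues along finite sets [S n]
    whose norms tend to the infimum [m] form a Cauchy sequence, and the limit is
    orthogonal to [E], since otherwise one more vector of [E] would bring the
    norm below [m]. *)
Lemma parseval_approx v (e : R) :
  (forall x, (forall f, E f -> dot x f = 0) -> x = 0) -> 0 < e ->
  exists s, [/\ uniq s, forall x, x \in s -> E x &
    nsq (residue s v) <= e].
Proof.
move=> maxE e0.
pose W := [set r | exists2 s : seq H, (forall x, x \in s ->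
  E x) & r = nsq (residue s v)].
have W0 : lbound W 0 by move=> _ [s _ ->]; exact: ip_ge0.
have Wv : W (nsq v) by exists [::].
have infW : has_inf W by split; [exists (nsq v)|exists 0].
set m := inf W.
have mW s : (forall x, x \in s -> E x) -> m <= nsq (residue s v).
  by move=> sE; apply: ge_inf; [exists 0|exists s].
have /choice[s0 s0P] : forall n, exists s : seq H, (forall x, x \in s -> E x) /\
    nsq (residue s v) <= m + n.+1%:R^-1.
  move=> n; have [|_ [s sE ->] /ltW h] := @inf_adherent _ W n.+1%:R^-1 _ infW.
    by rewrite invr_gt0.
  by exists s.
(* The sets are accumulated to make the residues decreasing in norm. *)
pose S := fix S n := if n is k.+1 then s0 n ++ S k else s0 0%N.
have SE n x : x \in S n -> E x.
  elim: n => [|n IH] /=; first by have [h _] := s0P 0%N; exact: h.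
  by rewrite mem_cat => /orP[|//]; have [h _] := s0P n.+1; exact: h.
have Smono k n : (k <= n)%N -> forall x, x \in S k -> x \in S n.
  elim: n => [|n IH]; first by rewrite leqn0 => /eqP ->.
  rewrite leq_eqVlt => /orP[/eqP ->//|kn] x xk.
  by rewrite /= mem_cat IH ?orbT.
have s0S n x : x \in s0 n -> x \in S n.
  by case: n => [|n] //=; rewrite mem_cat => ->.
pose w n := residue (S n) v.
have wm n : nsq (w n) <= m + n.+1%:R^-1.
  have [_] := s0P n; apply: le_trans.
  have := residue_incr v (SE n) (s0S n);
    have := ip_ge0 (residue (s0 n) v - w n).
  by rewrite /w; lra.
have [l wl] : exists l, hlim w l.
  apply: (@hlim_complete w (fun n => - nsq (w n)) 1 0) => //.
  - move=> k n kn; rewrite lerN2; have := residue_incr v (SE n) (Smono _ _ kn).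
    by have := ip_ge0 (w k - w n); rewrite /w; lra.
  - by move=> n; rewrite oppr_le0 ip_ge0.
  - move=> k n kn; have := residue_incr v (SE n) (Smono _ _ kn).
    by rewrite -opprB ipNl ipNr /w; lra.
have lE f : E f -> dot l f = 0.
  move=> Ef; apply: dot2_eq0; apply/eqP; rewrite eq_le dot2_ge0 andbT.
  apply/ler_addgt0Pl => d d0; rewrite addr0.
  have d4 : 0 < d / 4 by lra.
  have [N1 h1] := wl _ d4.
  pose N2 := Num.bound (4 / d); pose n := (N1 + N2)%N.
  have fin : n.+1%:R^-1 <= d / 4.
    have h : 4 / d <= n.+1%:R.
      apply: (@le_trans _ _ N2%:R).
        by apply/ltW/archi_boundP; rewrite divr_ge0 ?ltW.
      by rewrite ler_nat /n; apply: leqW; exact: leq_addl.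
    rewrite -[n.+1%:R^-1]mul1r ler_pdivrMr ?ltr0Sn //.
    have := ler_wpM2l (ltW d4) h; suff -> : d / 4 * (4 / d) = 1 by [].
    by field; rewrite gt_eqF.
  have wn : nsq (w n) <= m + d / 4 by apply: le_trans (wm n) _; rewrite lerD2l.
  have wf : dot2 (w n) f <= d / 4.
    have : m <= nsq (residue (f :: S n) v).
      by apply: mW => x; rewrite inE => /orP[/eqP ->//|/SE].
    by rewrite /= nsq_sub_unit //; move: wn; rewrite /w; lra.
  have lw : dot2 (l - w n) f <= d / 4.
    apply: le_trans (dot2_le _ _) _; rewrite {2}/ip (onE Ef Ef) eqxx /= mulr1.
    by rewrite -opprB ipNl ipNr opprK h1 ?leq_addr.
  have : dot2 l f <= 2 * dot2 (w n) f + 2 * dot2 (l - w n) f.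
    rewrite /dot2 !ipDl !ipNl.
    have := sqr_ge0 (ip l f - 2 * ip (w n) f).
    by have := sqr_ge0 (ip l ('i *: f) - 2 * ip (w n) ('i *: f)); nra.
  by lra.
have l0 := maxE _ lE.
have [N h] := wl _ e0; exists (undup (S N)); split; first exact: undup_uniq.
  by move=> x; rewrite mem_undup => /SE.
have -> : nsq (residue (undup (S N)) v) = nsq (w N).
  have a x : x \in S N -> x \in undup (S N) by rewrite mem_undup.
  have b x : x \in undup (S N) -> x \in S N by rewrite mem_undup.
  have bE x : x \in undup (S N) -> E x by move=> /b /SE.
  have h1 := residue_incr v bE a; have h2 := residue_incr v (SE N) b.
  have := ip_ge0 (residue (S N) v - residue (undup (S N)) v).
  by have := ip_ge0 (residue (undup (S N)) v - residue (S N) v); rewrite /w;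
    lra.
by have := h N (leqnn _); rewrite l0 subr0.
Qed.

End Residue.

Local Notation basis := (hbasis dot).

Lemma basis_orthonormal : orthonormal_set dot basis.
Proof. by have [] := hbasisP dot. Qed.

Lemma parseval v : (\esum_(f in basis) (dot2 v f)%:E = (nsq v)%:E)%E.
Proof.
apply/eqP; rewrite eq_le; apply/andP; split.
  by apply: esum_le_fin => s us sE; rewrite lee_fin (bessel basis_orthonormal).
apply/lee_addgt0Pr => e e0.
have [s [us sE se]] := parseval_approx basis_orthonormal v (proj2 (hbasisP dot)) e0.
apply: (@le_trans _ _ ((\sum_(f <- s) dot2 v f)%:E + e%:E)%E).
  rewrite -EFinD lee_fin; move: se.
  by rewrite (nsq_residue basis_orthonormal) //; lra.
by rewrite leeD2r //; exact: esum_ge_fin.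
Qed.

(** * The trace *)

Lemma dot_selfadj A x y : selfadj A -> dot (A x) y = dot x (A y).
Proof. by move=> [lA sA _]; rewrite !dot_ip -(linZ lA) !sA. Qed.

Lemma tr_ge0 A : psd A -> (0 <= tr dot A)%E.
Proof. by move=> pA; apply: esum_ge0 => x _; rewrite lee_fin;
  exact: psd_ge0. Qed.

Lemma tr_le A B : (forall x, ip (A x) x <= ip (B x) x) ->
  (tr dot A <= tr dot B)%E.
Proof. by move=> AB; apply: le_esum => x _; rewrite lee_fin; exact: AB. Qed.

Lemma trD A B : psd A -> psd B -> tr dot (A \+ B) = (tr dot A + tr dot B)%E.
Proof.
move=> pA pB; rewrite /tr -esumD.
- by apply: eq_esum => x _; rewrite -EFinD -!/(ip _ _) ipDl.
- by move=> x _; rewrite lee_fin; exact: psd_ge0.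
- by move=> x _; rewrite lee_fin; exact: psd_ge0.
Qed.

Lemma trZ r A : 0 <= r -> psd A ->
  tr dot (fun x => r *r A x) = (r%:E * tr dot A)%E.
Proof.
have le q B : 0 <= q -> psd B ->
    (tr dot (fun x => q *r B x) <= q%:E * tr dot B)%E.
  move=> q0 pB; apply: esum_le_fin => s us sE.
  apply: (@le_trans _ _ (q%:E * (\sum_(x <- s) ip (B x) x)%:E)%E).
    rewrite -EFinM lee_fin mulr_sumr le_eqVlt; apply/orP; left; apply/eqP.
    by apply: eq_bigr => x _; rewrite -/(ip _ _) ipZl.
  by rewrite lee_wpmul2l ?lee_fin //; exact: esum_ge_fin.
move=> r0 pA; apply/eqP; rewrite eq_le le //=.
have [{}r0|r1] : 0 < r \/ r = 0 by lra.
  rewrite -lee_pdivlMl //.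
  have := le r^-1 (fun x => r *r A x); rewrite invr_ge0 (ltW r0) => /(_ isT).
  have -> : (fun x => r^-1 *r (r *r A x)) = A.
    apply/funext => x; rewrite scalerA -rmorphM /= mulVf ?gt_eqF //.
    by rewrite rmorph1 scale1r.
  by apply; apply: psdZ => //; exact: ltW.
by subst r; rewrite mul0e; apply: tr_ge0; exact: psdZ.
Qed.

(** The trace does not increase under compression by a contraction: with
    [S] a square root of [A], both sides are sums of the squared matrix
    coefficients of [S K] and [K S], which agree up to transposition. *)
Lemma tr_sandwich A K : psd A -> selfadj K -> (forall x, nsq (K x) <= nsq x) ->
  (tr dot (K \o A \o K) <= tr dot A)%E.
Proof.
move=> pA sK K1; have [S [pS SS _]] := sqrt_exists pA.
have sS := psd_selfadj pS; have AE x : ip (A x) x = nsq (S x).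
  by rewrite -SS (selfadj_symm sS).
apply: esum_le_fin => s us sE.
apply: (@le_trans _ _ (\sum_(x <- s) \esum_(f in basis) (dot2 (S (K x)) f)%:E)%E).
  rewrite -sumEFin; apply: lee_sum => x _; rewrite parseval lee_fin.
  by rewrite -/(ip _ _) /= (selfadj_symm sK) AE.
rewrite -esum_sum; last by move=> *; rewrite lee_fin dot2_ge0.
apply: le_esum => f _; rewrite sumEFin lee_fin -/(ip _ _) AE.
apply: le_trans (K1 _); apply: le_trans (bessel basis_orthonormal _ us sE).
apply: ler_sum => x _; rewrite (dot2C (K (S f))) le_eqVlt; apply/orP; left.
by rewrite !dot2E !dot_selfadj.
Qed.

(** The operator [|x><x|]. *)
Definition rank1 x y : H := dot y x *: x.

Lemma rank1_ip x y : ip (rank1 x y) y = dot2 y x.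
Proof.
by rewrite dot2E /ip /rank1 linearZl_LR /= (dotC y x);
  case: (dot y x) => a b /=; ring.
Qed.

Lemma rank1_nsq x y : nsq (rank1 x y) = dot2 y x * nsq x.
Proof.
rewrite dot2E /ip /rank1 linearZl_LR linearZr_LR /= dot_normE.
by case: (dot y x) => a b /=; ring.
Qed.

Lemma rank1_psd x : psd (rank1 x).
Proof.
split=> [|y]; last by rewrite rank1_ip dot2_ge0.
split.
- by move=> a y z; rewrite /rank1 linearPl /= scalerDl scalerA.
- move=> y z; rewrite (ipC y) /ip /rank1 !linearZl_LR /= (dotC z x) (dotC y x).
  by case: (dot z x) => a b; case: (dot y x) => c d /=; ring.
- exists (nsq x * nsq x); split=> [|y]; first by rewrite mulr_ge0 ?ip_ge0.
  rewrite rank1_nsq mulrC -mulrA ler_wpM2l ?ip_ge0 // mulrC.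
  by apply: le_trans (dot2_le _ _) _.
Qed.

Lemma rank1_selfadj x : selfadj (rank1 x). Proof. exact:
  psd_selfadj (rank1_psd x). Qed.

Lemma tr_rank1 x : tr dot (rank1 x) = (nsq x)%:E.
Proof.
by rewrite -parseval; apply: eq_esum => y _; rewrite -/(ip _ _) rank1_ip dot2C.
Qed.

Lemma dot2Zr r x y : dot2 x (r *r y) = r ^+ 2 * dot2 x y.
Proof.
rewrite /dot2 scalerA mulrC -scalerA !ipZr; ring.
Qed.

Lemma rank1Z r x y : rank1 (r *r x) y = (r ^+ 2) *r rank1 x y.
Proof.
rewrite /rank1 linearZr_LR /= !scalerA; congr (_ *: _).
by case: (dot y x) => a b; apply/eqP; rewrite eq_complex /=; apply/andP; split;
  apply/eqP; ring.
Qed.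

(** A unit vector need not belong to the basis that defines the trace: compress
    [A] to the line of [x]. *)
Lemma tr_ge A x : psd A -> nsq x = 1 -> ((ip (A x) x)%:E <= tr dot A)%E.
Proof.
move=> pA x1; have a0 := psd_ge0 x pA.
have c1 y : nsq (rank1 x y) <= nsq y.
  by rewrite rank1_nsq x1 mulr1; apply: le_trans (dot2_le _ _) _;
    rewrite x1 mulr1.
apply: le_trans (tr_sandwich pA (rank1_selfadj x) c1).
have -> : ip (A x) x = nsq (Num.sqrt (ip (A x) x) *r x).
  by rewrite !ipE x1 mulr1 -expr2 sqr_sqrtr.
rewrite -tr_rank1; apply: tr_le => y.
rewrite rank1_ip dot2Zr sqr_sqrtr // (selfadj_symm (rank1_selfadj x)) /rank1.
rewrite (linZ (psd_lin pA)) /ip linearZl_LR linearZr_LR /= -/(ip _ _) dot2E.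
have -> : dot (A x) x = (ip (A x) x)%:C
  by rewrite dot_ip (selfadj_ii _ (psd_lin pA) (psd_symm pA)).
by case: (dot y x) => b c /=; rewrite le_eqVlt; apply/orP; left; apply/eqP;
  ring.
Qed.

(** * Positive trace class operators *)

Definition tcpos A : Prop := psd A /\ (tr dot A < +oo)%E.
Definition rtr A : R := fine (tr dot A).

Lemma tcposP A : trace_class_pos dot A <-> tcpos A.
Proof.
split=> [[[bA tA] /positive_psd pA]|[pA tA]];
  first by rewrite absop_psd // in tA.
have /positive_psd pA' := pA; split=> //.
by split; [case: pA'|rewrite absop_psd].
Qed.

Lemma tcpos_psd A : tcpos A -> psd A. Proof. by case. Qed.
Lemma tcpos_selfadj A : tcpos A -> selfadj A. Proof. by case=> -[]. Qed.

Lemma rtrE A : tcpos A -> tr dot A = (rtr A)%:E.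
Proof. by move=> [pA fA]; rewrite fineK // ge0_fin_numE ?tr_ge0. Qed.

Lemma rtr_ge0 A : tcpos A -> 0 <= rtr A.
Proof. by move=> tA; rewrite -lee_fin -rtrE //; apply: tr_ge0;
  exact: tcpos_psd. Qed.

Lemma tcposD A B : tcpos A -> tcpos B -> tcpos (A \+ B).
Proof.
move=> [pA fA] [pB fB]; split; first exact: psdD.
by rewrite trD // lte_add_pinfty.
Qed.

Lemma rtrD A B : tcpos A -> tcpos B -> rtr (A \+ B) = rtr A + rtr B.
Proof.
move=> tA tB; apply: EFin_inj; rewrite EFinD -!rtrE //; last exact: tcposD.
by apply: trD; exact: tcpos_psd.
Qed.

Lemma tcposZ r A : 0 <= r -> tcpos A -> tcpos (fun x => r *r A x).
Proof.
move=> r0 tA; have pA := tcpos_psd tA; split; first exact: psdZ.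
by rewrite trZ // rtrE // -EFinM ltry.
Qed.

Lemma rtrZ r A : 0 <= r -> tcpos A -> rtr (fun x => r *r A x) = r * rtr A.
Proof.
move=> r0 tA; apply: EFin_inj; rewrite EFinM -!rtrE //; last exact: tcposZ.
by apply: trZ => //; exact: tcpos_psd.
Qed.

Lemma tcpos_rank1 x : tcpos (rank1 x).
Proof. by split; [exact: rank1_psd|rewrite tr_rank1 ltry]. Qed.

Lemma rtr_rank1 x : rtr (rank1 x) = nsq x.
Proof. by rewrite /rtr tr_rank1. Qed.

Lemma tcpos0 : tcpos (fun=> 0).
Proof.
split; first exact: psd0.
by rewrite /tr esum1 // => x _; rewrite -/(ip _ _) ip0l.
Qed.

Lemma rtr0 : rtr (fun=> 0) = 0.
Proof. by rewrite /rtr /tr esum1 // => x _; rewrite -/(ip _ _) ip0l. Qed.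

Definition ople A B : Prop := forall x, ip (A x) x <= ip (B x) x.

Lemma tcpos_le A B : psd A -> ople A B -> tcpos B -> tcpos A.
Proof. by move=> pA AB [_ fB]; split=> //;
  apply: le_lt_trans (tr_le AB) fB. Qed.

Lemma rtr_ge A x : tcpos A -> nsq x = 1 -> ip (A x) x <= rtr A.
Proof. by move=> tA x1; rewrite -lee_fin -rtrE //; apply: tr_ge => //;
  exact: tcpos_psd. Qed.

Lemma unit_scale x : x != 0 -> exists2 y, nsq y = 1 & x = Num.sqrt (nsq x) *r y.
Proof.
move=> x0; have n0 := ip_gt0 x0; have s0 : 0 < Num.sqrt (nsq x)
  by rewrite sqrtr_gt0.
exists ((Num.sqrt (nsq x))^-1 *r x).
  rewrite !ipE mulrA -expr2 exprVn sqr_sqrtr ?(ltW n0) //.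
  by rewrite mulVf // gt_eqF.
by rewrite scalerA -rmorphM /= mulfV ?gt_eqF // rmorph1 scale1r.
Qed.

Lemma rtr_eq0 A : tcpos A -> rtr A = 0 -> forall x, A x = 0.
Proof.
move=> tA A0 x; have pA := tcpos_psd tA; have lA := psd_lin pA.
have [->|/unit_scale[y y1 ->]] := eqVneq x 0; first exact: lin0.
rewrite (linZ lA); have := rtr_ge tA y1; have := psd_ge0 y pA;
  rewrite A0 => h1 h2.
by rewrite (psd_ker (x := y) pA) ?scaler0 //; lra.
Qed.

(** * The trace distance *)

Definition tdist A B : R := fine (d1 dot A B).

(** The Jordan decomposition of a difference of positive trace class operators
    is minimal among all such decompositions: by [jordan_cutoff] the finite sums
    of the trace of [P] are bounded by those of a compression of [A'], up to
    an arbitrarily small error. *)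
Lemma trnorm_jordan A B : tcpos A -> tcpos B -> exists P T,
  [/\ tcpos P, tcpos T, forall x, P x - T x = A x - B x,
      d1 dot A B = (rtr P + rtr T)%:E &
      forall A' B', tcpos A' -> tcpos B' ->
        (forall x, A' x - B' x = A x - B x) ->
        rtr P <= rtr A' /\ rtr T <= rtr B'].
Proof.
move=> tA tB.
have sD : selfadj (A \- B) by apply: selfadjB; exact: tcpos_selfadj.
have [P [T [pP pT DPT absD PT]]] := jordan sD.
have half P1 T1 A1 B1 : psd P1 -> psd T1 -> tcpos A1 -> psd B1 ->
    (forall x, A1 x - B1 x = P1 x - T1 x) -> (forall x, T1 (P1 x) = 0) ->
    (tr dot P1 <= tr dot A1)%E.
  move=> pP1 pT1 tA1 pB1 e TP; apply: esum_le_fin => s us sE.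
  apply/lee_addgt0Pr => d d0.
  have [K [sK K1 le]] := jordan_cutoff s pB1 pP1 pT1 e TP d0.
  apply: (@le_trans _ _ ((\sum_(x <- s) ip (A1 (K x)) (K x))%:E + d%:E)%E).
    by rewrite -EFinD lee_fin; exact: le.
  rewrite leeD2r //; apply: le_trans (tr_sandwich (tcpos_psd tA1) sK K1).
  apply: le_trans (esum_ge_fin _ us sE).
  rewrite lee_fin le_eqVlt; apply/orP; left; apply/eqP.
  by apply: eq_bigr => x _; rewrite -/(ip _ _) /= (selfadj_symm sK).
have min A' B' : tcpos A' -> tcpos B' -> (forall x, A' x - B' x = A x - B x) ->
    (tr dot P <= tr dot A' /\ tr dot T <= tr dot B')%E.
  move=> tA' tB' e; split.
    apply: (half _ T _ B') => // [|x|x]; first exact: tcpos_psd.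
      by rewrite e -DPT.
    by have [] := PT x.
  apply: (half _ P _ A') => // [|x|x]; first exact: tcpos_psd.
    by rewrite -[LHS]opprB -[RHS]opprB e -DPT.
  by have [] := PT x.
have [PA TB] := min A B tA tB (fun=> erefl).
have tP : tcpos P by split=> //; apply: le_lt_trans PA _; case: tA.
have tT : tcpos T by split=> //; apply: le_lt_trans TB _; case: tB.
exists P, T; split=> //.
- by move=> x; rewrite -DPT.
- rewrite /d1 /trnorm (_ : absop dot _ = P \+ T); last exact/funext.
  by rewrite trD // (rtrE tP) (rtrE tT).
- by move=> A' B' tA' tB' e; rewrite -!lee_fin -!rtrE //; exact: min.
Qed.

Lemma rtr_balance A B P T : tcpos A -> tcpos B -> tcpos P -> tcpos T ->
  (forall x, P x - T x = A x - B x) -> rtr P + rtr B = rtr A + rtr T.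
Proof.
move=> tA tB tP tT e; rewrite -!rtrD //; congr rtr; apply/funext => x /=.
by rewrite -[P x](subrK (T x)) e addrAC subrK.
Qed.

Lemma tdist_jordan A B : tcpos A -> tcpos B -> exists P T,
  [/\ tcpos P, tcpos T, forall x, P x - T x = A x - B x &
    tdist A B = rtr P + rtr T].
Proof.
move=> tA tB; have [P [T [tP tT e dE _]]] := trnorm_jordan tA tB.
by exists P, T; rewrite /tdist dE.
Qed.

Lemma tdist_le A B P T : tcpos A -> tcpos B -> tcpos P -> tcpos T ->
  (forall x, P x - T x = A x - B x) -> tdist A B <= rtr P + rtr T.
Proof.
move=> tA tB tP tT e; have [P' [T' [_ _ _ dE /(_ P T tP tT e)[]]]] :=
  trnorm_jordan tA tB.
by rewrite /tdist dE /=; lra.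
Qed.

Lemma tdist_sym A B : tcpos A -> tcpos B -> tdist A B = tdist B A.
Proof.
suff le A1 B1 : tcpos A1 -> tcpos B1 -> tdist A1 B1 <= tdist B1 A1.
  by move=> tA tB; apply/eqP; rewrite eq_le !le.
move=> tA tB; have [P [T [tP tT e ->]]] := tdist_jordan tB tA.
by rewrite addrC; apply: tdist_le => // x; rewrite -opprB e opprB.
Qed.

Lemma tdist_tri A B D : tcpos A -> tcpos B -> tcpos D ->
  tdist A D <= tdist A B + tdist B D.
Proof.
move=> tA tB tD; have [P [T [tP tT e ->]]] := tdist_jordan tA tB.
have [P' [T' [tP' tT' e' ->]]] := tdist_jordan tB tD.
rewrite addrACA -(rtrD tP tP') -(rtrD tT tT').
apply: tdist_le => //; try exact: tcposD.
by move=> x /=; rewrite opprD addrACA e e' addrA subrK.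
Qed.

Lemma tdist_ople A B : tcpos A -> tcpos B -> ople A B ->
  tdist A B = rtr B - rtr A.
Proof.
move=> tA tB AB; apply/eqP; rewrite eq_le; apply/andP; split.
  have pC : psd (B \- A).
    split=> [|x /=]; first by apply: selfadjB; exact: tcpos_selfadj.
    by rewrite !ipE subr_ge0; exact: AB.
  have tC : tcpos (B \- A).
    apply: tcpos_le tB => // x /=; rewrite !ipE gerBl;
      exact: psd_ge0 (tcpos_psd tA).
  have := @tdist_le A B (fun=> 0) (B \- A) tA tB tcpos0 tC.
  have := @rtr_balance B A (B \- A) (fun=> 0) tB tA tC tcpos0.
  rewrite !rtr0 => /(_ (fun x => ltac:(by rewrite subr0))) h1.
  by move=> /(_ (fun x => ltac:(by rewrite /= sub0r opprB))); lra.
have [P [T [tP tT e ->]]] := tdist_jordan tA tB.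
by have := rtr_balance tA tB tP tT e; have := rtr_ge0 tP; lra.
Qed.

(** If [A - B = P - T], then [tr B - tr A = tr T - tr P], which is the distance
    [tr P + tr T] only if [P = 0]. *)
Lemma tdist_opleP A B : tcpos A -> tcpos B -> (ople A B <->
  tdist A B = rtr B - rtr A).
Proof.
move=> tA tB; split; first exact: tdist_ople.
have [P [T [tP tT e ->]]] := tdist_jordan tA tB.
have h := rtr_balance tA tB tP tT e => h' x.
have P0 : rtr P = 0 by lra.
have := psd_ge0 x (tcpos_psd tT); have := congr1 (ip^~ x) (e x).
by rewrite (rtr_eq0 tP P0) !ipE; lra.
Qed.

Lemma tdist0 A : tcpos A -> tdist (fun=> 0) A = rtr A.
Proof.
move=> tA; rewrite tdist_ople ?rtr0 ?subr0 //; first exact: tcpos0.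
by move=> x; rewrite ipE; exact: psd_ge0 (tcpos_psd tA).
Qed.

Lemma tdist_scale r A B : 0 < r -> tcpos A -> tcpos B ->
  r * tdist A B <= tdist (fun x => r *r A x) (fun x => r *r B x).
Proof.
move=> r0 tA tB; have r1 := ltW r0.
have [P [T [tP tT e ->]]] := tdist_jordan (tcposZ r1 tA) (tcposZ r1 tB).
have r2 : 0 <= r^-1 by rewrite invr_ge0.
have := @tdist_le A B (fun x => r^-1 *r P x) (fun x => r^-1 *r T x) tA tB
  (tcposZ r2 tP) (tcposZ r2 tT).
rewrite !rtrZ // -mulrDr -ler_pdivlMl // => h; apply: h => x.
rewrite -scalerBr e -scalerBr scalerA -rmorphM /= mulVf ?gt_eqF //.
by rewrite rmorph1 scale1r.
Qed.

Lemma tdist_rank1_lb A x t : tcpos A -> nsq x = 1 -> 0 <= t ->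
  rtr A + t - 2 * ip (A x) x <= tdist A (fun y => t *r rank1 x y).
Proof.
move=> tA x1 t0; have tR := tcposZ t0 (tcpos_rank1 x).
have [P [T [tP tT e ->]]] := tdist_jordan tA tR.
have := rtr_balance tA tR tP tT e;
  rewrite (rtrZ t0 (tcpos_rank1 x)) rtr_rank1 x1.
have := rtr_ge tT x1; have := psd_ge0 x (tcpos_psd tP).
have := congr1 (ip^~ x) (e x); rewrite !ipE rank1_ip.
have -> : dot2 x x = 1 by rewrite dot2E dot_normE x1 /=; ring.
by lra.
Qed.

(** With [w = t x - A x], the rank one operator [|w><w| / (t - <A x, x>)]
    cancels [A - t |x><x|] on [x], which leaves a positive operator. *)
Lemma tdist_rank1_ub A x t : tcpos A -> nsq x = 1 -> 0 <= t -> ip (A x) x < t ->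
  tdist A (fun y => t *r rank1 x y) <= rtr A + t - 2 * ip (A x) x +
    2 * ((nsq (A x) - ip (A x) x ^+ 2) / (t - ip (A x) x)).
Proof.
move=> tA x1 t0 at_; have tR := tcposZ t0 (tcpos_rank1 x).
set a := ip (A x) x in at_ *.
have pA := tcpos_psd tA; have lA := psd_lin pA.
have t_a : 0 < t - a by lra.
have i0 : 0 <= (t - a)^-1 by rewrite invr_ge0 ltW.
have dAx : dot (A x) x = a%:C by rewrite dot_ip (selfadj_ii _ lA (psd_symm pA)).
have dxx : dot x x = 1 by rewrite dot_normE x1.
pose w := t *r x - A x.
pose B y := (t - a)^-1 *r rank1 w y.
have tB : tcpos B by exact: tcposZ (tcpos_rank1 w).
pose C y := A y - t *r rank1 x y + B y.
have sC : selfadj C.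
  by apply: (@selfadjD (fun y => A y - t *r rank1 x y)); [apply: selfadjB|];
    exact: tcpos_selfadj.
have Cx : C x = 0.
  have dxw : dot x w = (t - a)%:C.
    rewrite /w linearBr linearZr_LR /= dxx (dotC (A x) x) dAx mulr1 rmorphB.
    by congr (_ - _); apply/eqP; rewrite eq_complex /= oppr0 !eqxx.
  rewrite /C /B /rank1 dxx dxw scale1r scalerA -rmorphM /= mulVf ?gt_eqF //.
  by rewrite rmorph1 scale1r /w addrA subrK subrr.
have pos z : dot2 z x = 0 -> 0 <= ip (C z) z.
  move=> zx; rewrite /C /B !ipE !rank1_ip zx mulr0 subr0 addr_ge0 //.
    exact: psd_ge0.
  by rewrite mulr_ge0 // dot2_ge0.
have pC : psd C.
  split=> // y; pose z := y - dot y x *: x.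
  have Cy : C y = C z by rewrite (linB (selfadj_lin sC)) (linZ (selfadj_lin sC)) Cx scaler0 subr0.
  have -> : ip (C y) y = ip (C z) z.
    by rewrite Cy !(selfadj_symm sC) Cy.
  apply: pos.
  by rewrite dot2E /z linearBl /= linearZl_LR /= dxx mulr1 subrr /=; ring.
have tC : tcpos C.
  apply: (tcpos_le pC _ (tcposD tA tB)) => y; rewrite /C /= !ipE rank1_ip.
  by have := mulr_ge0 t0 (dot2_ge0 y x); lra.
have CB y : C y - B y = A y - t *r rank1 x y by rewrite /C addrK.
have := tdist_le tA tR tC tB CB.
have := rtr_balance tA tR tC tB CB;
  rewrite (rtrZ t0 (tcpos_rank1 x)) rtr_rank1 x1.
rewrite (rtrZ i0 (tcpos_rank1 w)) rtr_rank1 => h1 h2; apply: le_trans h2 _.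
have -> : rtr C = rtr A + (t - a)^-1 * nsq w - t by lra.
have -> : nsq w = (t - a) ^+ 2 + (nsq (A x) - a ^+ 2).
  by rewrite /w !ipE x1 (ipC x) -/a; ring.
have e : (t - a)^-1 * ((t - a) ^+ 2 + (nsq (A x) - a ^+ 2)) =
    t - a + (nsq (A x) - a ^+ 2) / (t - a).
  by field; rewrite gt_eqF.
by rewrite e; lra.
Qed.

(** The quadratic form of [A] can be read off from the asymptotics
    [tdist A (t |x><x|) = t + rtr A - 2 <A x, x> + O(1 / t)]. *)
Lemma tdist_rank1_quad A B x y : tcpos A -> tcpos B -> nsq x = 1 ->
  nsq y = 1 -> rtr A = rtr B ->
  (forall t, 0 <= t ->
    tdist A (fun z => t *r rank1 x z) = tdist B (fun z => t *r rank1 y z)) ->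
  ip (A x) x = ip (B y) y.
Proof.
suff le A1 B1 x1 y1 : tcpos A1 -> tcpos B1 -> nsq x1 = 1 -> nsq y1 = 1 ->
  rtr A1 = rtr B1 ->
    (forall t, 0 <= t ->
      tdist A1 (fun z => t *r rank1 x1 z) = tdist B1 (fun z =>
        t *r rank1 y1 z)) ->
    ip (A1 x1) x1 <= ip (B1 y1) y1.
  move=> tA tB x1 y1 AB e; apply/eqP; rewrite eq_le !le // => t t0.
  by rewrite e.
move=> {A B x y}; move: A1 B1 x1 y1 => A B x y tA tB x1 y1 AB e;
  rewrite leNgt; apply/negP => ba.
set a := ip (A x) x in ba; set b := ip (B y) y in ba.
have a0 : 0 <= a by exact: psd_ge0 (tcpos_psd tA).
have C0 : 0 <= nsq (A x) - a ^+ 2.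
  by have := cauchy_schwarz (A x) x; rewrite x1 mulr1 -/a; lra.
set C := nsq (A x) - a ^+ 2 in C0.
(* At this [t] the error term [C / (t - a)] is smaller than [a - b]. *)
pose t := a + (2 * C / (a - b) + 1).
have q0 : 0 <= 2 * C / (a - b) by rewrite divr_ge0 ?mulr_ge0 //; lra.
have t0 : 0 <= t by rewrite /t; lra.
have at_ : a < t by rewrite /t; lra.
have := tdist_rank1_ub tA x1 t0 at_; have := tdist_rank1_lb tB y1 t0;
  rewrite e // -/a -/b -/C AB.
have : C / (t - a) < a - b.
  rewrite ltr_pdivrMr; last by lra.
  have -> : (a - b) * (t - a) = 2 * C + (a - b) by rewrite /t; field; lra.
  by lra.
by lra.
Qed.

(** * Rank one operators and order intervals *)

Lemma dotDl x y z : dot (x + y) z = dot x z + dot y z.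
Proof. by rewrite linearDl. Qed.
Lemma dotDr x y z : dot x (y + z) = dot x y + dot x z.
Proof. by rewrite linearDr. Qed.
Lemma dotZl (k : R[i]) x y : dot (k *: x) y = k * dot x y.
Proof. by rewrite linearZl_LR. Qed.
Lemma dotZr (k : R[i]) x y : dot x (k *: y) = Num.conj k * dot x y.
Proof. by rewrite linearZr_LR. Qed.
Lemma dotNl x y : dot (- x) y = - dot x y.
Proof. by rewrite linearNl. Qed.
Lemma dotNr x y : dot x (- y) = - dot x y.
Proof. by rewrite linearNr. Qed.
Definition dotE := (dotDl, dotDr, dotNl, dotNr, dotZl, dotZr).

Lemma dot_eq0 x : dot x x = 0 -> x = 0.
Proof. by move=> /eqP; rewrite dnorm_eq0 => /eqP. Qed.

Lemma conjR r : Num.conj (r%:C : R[i]) = r%:C.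
Proof. by apply/eqP; rewrite eq_complex /= oppr0 !eqxx. Qed.

Lemma colinear x y : (forall z, dot z y = 0 -> dot z x = 0) ->
  exists k, x = k *: y.
Proof.
move=> yx; have [y0|y0] := eqVneq y 0.
  by exists 0; rewrite scale0r; apply/dot_eq0/yx; rewrite y0 linear0r.
have d0 : dot y y != 0 by rewrite dnorm_eq0.
pose k := dot x y / dot y y; exists k.
have zy : dot (x - k *: y) y = 0 by rewrite !dotE divfK // subrr.
apply/eqP; rewrite -subr_eq0; apply/eqP/dot_eq0.
rewrite [X in X = 0]dotDr dotNr dotZr zy mulr0 subr0.
exact: yx.
Qed.

Lemma rank1_eqP x y : (forall z, rank1 x z = rank1 y z) -> exists k, x = k *: y.
Proof.
move=> xy; apply: colinear => z zy; have := xy z; rewrite /rank1 zy scale0r.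
move=> /(congr1 (dot^~ z)); rewrite /= dotZl (dotC z x) linear0l => /eqP.
by rewrite mulf_eq0 => /orP[]/eqP // /(congr1 Num.conj); rewrite conjCK conjC0.
Qed.

Lemma psd_cauchy2 A x y : psd A -> dot2 (A x) y <= ip (A x) x * ip (A y) y.
Proof.
move=> pA; pose z := dot (A x) y *: y.
have e1 : ip (A x) z = dot2 (A x) y.
  by rewrite dot2E /z /ip dotZr; case: (dot (A x) y) => a b /=; ring.
have e2 : ip (A z) z = dot2 (A x) y * ip (A y) y.
  rewrite dot2E /z (linZ (psd_lin pA)) /ip dotZr dotZl.
  by case: (dot (A x) y) => a b; case: (dot (A y) y) => c d /=; ring.
have := psd_cauchy x z pA; rewrite e1 e2.
have [->|n0] := eqVneq (dot2 (A x) y) 0; first by rewrite mulr_ge0 ?psd_ge0.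
have d0 : 0 < dot2 (A x) y by rewrite lt_def n0 dot2_ge0.
by rewrite expr2 mulrCA ler_pM2l.
Qed.

(** [B] vanishes on the complement of [x], because its form does, and so its
    range is spanned by [x]. *)
Lemma below_rank1 B x : psd B -> ople B (rank1 x) ->
  exists2 r, 0 <= r & forall y, B y = r *r rank1 x y.
Proof.
move=> pB Bx; have lB := psd_lin pB.
have Bz z : dot z x = 0 -> B z = 0.
  move=> zx; apply: (psd_ker pB); apply/eqP; rewrite eq_le psd_ge0 // andbT.
  by apply: le_trans (Bx z) _; rewrite rank1_ip dot2E zx /=; lra.
have [k Bk] : exists k, B x = k *: x.
  apply: colinear => z /Bz zB;
    by rewrite -(dot_selfadj _ _ (psd_selfadj pB)) zB linear0l.
have [x0|x0] := eqVneq x 0.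
  exists 0 => // y; rewrite scale0r; apply: Bz.
  by rewrite x0 linear0r.
have d0 : dot x x != 0 by rewrite dnorm_eq0.
pose s := ip (B x) x / nsq x.
have s0 : 0 <= s by rewrite divr_ge0 ?ip_ge0 ?psd_ge0.
have kE : k = s%:C.
  have : dot (B x) x = (ip (B x) x)%:C
    by rewrite dot_ip (selfadj_ii _ lB (psd_symm pB)).
  rewrite Bk dotZl -Bk => e; rewrite /s rmorphM /= fmorphV /= -dot_normE -e.
  by rewrite mulfK.
exists (s / nsq x) => [|y]; first by rewrite divr_ge0 ?ip_ge0.
have : B (y - (dot y x / dot x x) *: x) = 0.
  by apply: Bz; rewrite !dotE divfK // subrr.
rewrite (linB lB) (linZ lB) Bk kE => /eqP; rewrite subr_eq0 => /eqP ->.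
rewrite /rank1 !scalerA dot_normE [in RHS]rmorphM /= fmorphV /=.
by congr (_ *: _); ring.
Qed.

Definition chain A : Prop := forall B D, tcpos B -> tcpos D ->
  ople B A -> ople D A -> ople B D \/ ople D B.

Lemma chain_rank1 x : chain (rank1 x).
Proof.
move=> B D tB tD /(below_rank1 (tcpos_psd tB))[r r0 Br]
  /(below_rank1 (tcpos_psd tD))[s s0 Ds].
have [rs|/ltW sr] := leP r s; [left|right] => y; rewrite Br Ds !ipE rank1_ip.
  by rewrite ler_wpM2r ?dot2_ge0.
by rewrite ler_wpM2r ?dot2_ge0.
Qed.

(** When [A x] is nonzero, [|A x><A x| / <A x, x>] lies below [A], by the
    Cauchy-Schwarz inequality for the form of [A]. Two such operators are
    comparable only if they have the same range, so that [A] has rank one. *)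
Lemma rank1_chain A : tcpos A -> chain A -> exists x, A = rank1 x.
Proof.
move=> tA cA; have pA := tcpos_psd tA; have lA := psd_lin pA.
have [A0|/existsNP[p Ap0]] := pselect (forall x, A x = 0).
  by exists 0; apply/funext => x; rewrite A0 /rank1 scaler0.
have pos x : A x <> 0 -> 0 < ip (A x) x.
  move=> Ax; rewrite lt_def psd_ge0 // andbT; apply/eqP => /(psd_ker pA).
  exact: Ax.
pose B x y := (ip (A x) x)^-1 *r rank1 (A x) y.
have B_A x : A x <> 0 -> tcpos (B x) /\ ople (B x) A.
  move=> /pos Ax; split; first by apply: tcposZ (tcpos_rank1 _);
    rewrite invr_ge0 ltW.
  move=> y; rewrite /B !ipE rank1_ip mulrC ler_pdivrMr // dot2C mulrC.
  exact: psd_cauchy2.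
have orth x y z : A x <> 0 -> A y <> 0 -> ople (B x) (B y) ->
    dot z (A y) = 0 -> dot z (A x) = 0.
  move=> /pos x0 /pos y0 /(_ z) + zy; rewrite /B !ipE !rank1_ip.
  have -> : dot2 z (A y) = 0 by rewrite dot2E zy /=; ring.
  rewrite mulr0 pmulr_rle0 ?invr_gt0 // => h.
  by apply: dot2_eq0; apply/eqP; rewrite eq_le h dot2_ge0.
have par x : exists k, A x = k *: A p.
  have [Ax0|Ax0] := pselect (A x = 0); first by exists 0; rewrite scale0r.
  have [tx xA] := B_A _ Ax0; have [tp pA'] := B_A _ Ap0.
  have [xp|px] := cA _ _ tx tp xA pA'.
    by apply: colinear => z; exact: orth.
  have [k Apk] : exists k, A p = k *: A x.
    by apply: colinear => z; exact: orth.
  exists k^-1; rewrite Apk scalerA mulVf ?scale1r //.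
  by apply/eqP => k0; apply: Ap0; rewrite Apk k0 scale0r.
have d0 : dot (A p) (A p) != 0 by rewrite dnorm_eq0; apply/eqP.
have n0 : 0 < nsq (A p) by apply: ip_gt0; apply/eqP.
set q := A p in par d0 n0.
have [c Aq] := par q.
have cE : c = (ip (A q) q / nsq q)%:C.
  have : dot (A q) q = (ip (A q) q)%:C
    by rewrite dot_ip (selfadj_ii _ lA (psd_symm pA)).
  rewrite Aq dotZl -Aq => e; rewrite rmorphM /= fmorphV /= -dot_normE -e.
  by rewrite mulfK.
set r := ip (A q) q / nsq q in cE.
have r0 : 0 <= r by rewrite divr_ge0 ?ip_ge0 ?psd_ge0.
exists (Num.sqrt (r / nsq q) *r q); apply/funext => y.
rewrite rank1Z sqr_sqrtr; last by rewrite divr_ge0 ?ip_ge0.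
have [k Ak] := par y; rewrite Ak /rank1 scalerA; congr (_ *: _).
have e : k * dot q q = r%:C * dot y q.
  transitivity (dot (A y) q); first by rewrite Ak dotZl.
  by rewrite (dot_selfadj _ _ (psd_selfadj pA)) Aq cE dotZr conjR.
apply: (mulIf d0); rewrite e [(r / nsq q)%:C]rmorphM /= fmorphV /= -dot_normE.
by rewrite [in RHS]mulrAC divfK.
Qed.

(** * Isometries of the cone *)

Section Isometry.
Variables phi psi : (H -> H) -> (H -> H).
Hypothesis phi_tcpos : forall A, tcpos A -> tcpos (phi A).
Hypothesis psi_tcpos : forall A, tcpos A -> tcpos (psi A).
Hypothesis psiK : forall A, tcpos A -> phi (psi A) = A.
Hypothesis phi_tdist : forall A B, tcpos A -> tcpos B ->
  tdist (phi A) (phi B) = tdist A B.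

Local Notation zero := (fun=> 0 : H).

(** Let [A = phi 0] and [B = psi 0]. That [A] lies between [0] and
    [F = A + phi (2 B)] is transported to: [0] lies between [B] and [psi F].
    By homogeneity [0] then lies between [2 B] and [psi F], so that the distance
    [tr A] of [phi (2 B)] and [F] is at least [2 tr B = 2 tr A]. *)
Lemma phi_zero : phi zero = zero.
Proof.
have t0 := tcpos0; pose A := phi zero; pose B := psi zero.
have tA : tcpos A by exact: phi_tcpos.
have tB : tcpos B by exact: psi_tcpos.
have AB : rtr A = rtr B.
  have := phi_tdist t0 tB; rewrite /B psiK // -/B !tdist0 // => <-.
  by rewrite tdist_sym // tdist0.
have p2 : 0 <= 2 :> R by [].
have t2B := tcposZ p2 tB.
pose C := phi (fun x => 2 *r B x); have tC : tcpos C by exact: phi_tcpos.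
pose F := A \+ C; have tF : tcpos F by exact: tcposD.
pose E := psi F; have tE : tcpos E by exact: psi_tcpos.
have CF : tdist C F = rtr A.
  rewrite tdist_ople // ?rtrD //; first by ring.
  by move=> x; rewrite /F /= ipDl lerDr psd_ge0 //; exact: tcpos_psd.
have AF : tdist A F = rtr C.
  rewrite tdist_ople // ?rtrD //; first by ring.
  by move=> x; rewrite /F /= ipDl lerDl psd_ge0 //; exact: tcpos_psd.
have EC : rtr E = rtr C.
  by rewrite -AF -(tdist0 tE) -phi_tdist // psiK.
have BE : tdist B E = rtr A + rtr C.
  by rewrite -phi_tdist // !psiK // tdist0 // rtrD.
have CE : tdist (fun x => 2 *r B x) E = rtr A.
  by rewrite -phi_tdist // psiK.
have t2E := tcposZ p2 tE.
have E2 : tdist E (fun x => 2 *r E x) = rtr E.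
  rewrite tdist_ople // ?rtrZ //; first by ring.
  by move=> x; rewrite ipE; have := psd_ge0 x (tcpos_psd tE); lra.
have A0 : rtr A = 0.
  have := tdist_scale (ltr0Sn R 1) tB tE; have := tdist_tri t2B tE t2E;
    have := rtr_ge0 tA; have := rtr_ge0 tC.
  by rewrite CE E2 BE EC; lra.
by apply/funext => x; exact: rtr_eq0.
Qed.

Lemma phi_rtr A : tcpos A -> rtr (phi A) = rtr A.
Proof.
move=> tA; rewrite -tdist0; last exact: phi_tcpos.
by rewrite -{1}phi_zero phi_tdist ?tdist0 //; exact: tcpos0.
Qed.

Lemma phi_ople A B : tcpos A -> tcpos B -> ople (phi A) (phi B) <-> ople A B.
Proof.
move=> tA tB; rewrite !tdist_opleP //; try exact: phi_tcpos.
by rewrite phi_tdist // !phi_rtr.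
Qed.

Lemma phi_chain A : tcpos A -> chain A -> chain (phi A).
Proof.
move=> tA cA B D tB tD; rewrite -(psiK tB) -(psiK tD) => BA DA.
have [tB' tD'] := (psi_tcpos tB, psi_tcpos tD).
have [] := cA (psi B) (psi D) tB' tD'; try exact/phi_ople.
  by left; apply/phi_ople.
by right; apply/phi_ople.
Qed.

Lemma phi_rank1 x : exists y, phi (rank1 x) = rank1 y.
Proof.
apply: rank1_chain; first exact/phi_tcpos/tcpos_rank1.
by apply: phi_chain; [exact: tcpos_rank1|exact: chain_rank1].
Qed.

Lemma below_rank1_eq x y : ople (rank1 x) (rank1 y) ->
  forall z, nsq y *r rank1 x z = nsq x *r rank1 y z.
Proof.
move=> /(below_rank1 (rank1_psd x))[r r0 e] z.
have : rtr (rank1 x) = r * rtr (rank1 y) by rewrite -rtrZ //; [congr rtr;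
  exact/funext|exact: tcpos_rank1].
by rewrite !rtr_rank1 e => ->; rewrite scalerA -rmorphM mulrC.
Qed.

(** [t |x><x|] and [|x><x|] are comparable, hence so are their images, which are
    therefore proportional; the trace gives the factor. *)
Lemma phi_rank1Z x y z t : 0 <= t -> nsq x = 1 -> phi (rank1 x) = rank1 y ->
  phi (fun w => t *r rank1 x w) z = t *r rank1 y z.
Proof.
move=> t0 x1 xy; pose s := Num.sqrt t; have s2 : s ^+ 2 = t by exact: sqr_sqrtr.
have tE : (fun w => t *r rank1 x w) = rank1 (s *r x).
  by apply/funext => w; rewrite rank1Z s2.
rewrite tE; have [y' sy] := phi_rank1 (s *r x).
have y1 : nsq y = 1 by rewrite -rtr_rank1 -xy phi_rtr ?rtr_rank1 //;
  exact: tcpos_rank1.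
have y't : nsq y' = t.
  rewrite -rtr_rank1 -sy phi_rtr; last exact: tcpos_rank1.
  by rewrite rtr_rank1 !ipE x1 mulr1 -expr2.
rewrite sy; have [t1|/ltW t1] := leP t 1.
  have : ople (rank1 y') (rank1 y).
    rewrite -sy -xy; apply/phi_ople; try exact: tcpos_rank1.
    by move=> w; rewrite !rank1_ip dot2Zr s2 ler_piMl ?dot2_ge0.
  by move=> /below_rank1_eq/(_ z); rewrite y1 y't rmorph1 scale1r.
have : ople (rank1 y) (rank1 y').
  rewrite -sy -xy; apply/phi_ople; try exact: tcpos_rank1.
  by move=> w; rewrite !rank1_ip dot2Zr s2 ler_peMl ?dot2_ge0.
by move=> /below_rank1_eq/(_ z); rewrite y1 y't rmorph1 scale1r.
Qed.

Lemma phi_quad A x y : tcpos A -> nsq x = 1 -> phi (rank1 x) = rank1 y ->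
  ip (phi A y) y = ip (A x) x.
Proof.
move=> tA x1 xy.
have y1 : nsq y = 1 by rewrite -rtr_rank1 -xy phi_rtr ?rtr_rank1 //;
  exact: tcpos_rank1.
symmetry; apply: tdist_rank1_quad => //; try exact: phi_tcpos.
  by rewrite phi_rtr.
move=> t t0; have tR := tcposZ t0 (tcpos_rank1 x).
rewrite -phi_tdist //; congr tdist; apply/funext => z; exact: phi_rank1Z.
Qed.

Lemma phi_dot2 x y x' y' : phi (rank1 x) = rank1 x' ->
  phi (rank1 y) = rank1 y' ->
  dot2 x' y' = dot2 x y.
Proof.
have zero_rank1 z z' : phi (rank1 z) = rank1 z' -> z = 0 -> z' = 0.
  move=> zz z0; apply: ip_eq0; rewrite -rtr_rank1 -zz phi_rtr;
    last exact: tcpos_rank1.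
  by rewrite rtr_rank1 z0 ip0l.
move=> xx yy.
have [x0|/unit_scale[u u1 xu]] := eqVneq x 0.
  by rewrite (zero_rank1 _ _ xx x0) x0 /dot2 !ip0l.
have [y0|/unit_scale[v v1 yv]] := eqVneq y 0.
  by rewrite (zero_rank1 _ _ yy y0) y0 /dot2 scaler0 !ip0r.
have [u' uu] := phi_rank1 u; have [v' vv] := phi_rank1 v.
have scal z z' w w' : nsq z = 1 -> w = Num.sqrt (nsq w) *r z ->
    phi (rank1 z) = rank1 z' -> phi (rank1 w) = rank1 w' ->
    forall p, dot2 p w' = nsq w * dot2 p z'.
  move=> z1 wz zz ww p; rewrite -!rank1_ip -ww.
  have -> : rank1 w = fun q => nsq w *r rank1 z q.
    by apply/funext => q; rewrite {1}wz rank1Z sqr_sqrtr ?ip_ge0.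
  by rewrite (phi_rank1Z _ (ip_ge0 w) z1 zz) ipE rank1_ip.
rewrite (scal _ _ _ _ v1 yv vv yy) dot2C (scal _ _ _ _ u1 xu uu xx) dot2C.
have -> : dot2 u' v' = dot2 u v.
  by rewrite -(rank1_ip v' u') -vv (phi_quad (tcpos_rank1 v) u1 uu) rank1_ip.
rewrite [in RHS]yv dot2Zr [in RHS]dot2C [in RHS]xu dot2Zr !sqr_sqrtr ?ip_ge0 //.
by rewrite (dot2C v); ring.
Qed.

End Isometry.

(** * Wigner's theorem *)

Lemma dot2Zl (k : R[i]) x y : dot2 (k *: x) y =
  (complex.Re k ^+ 2 + complex.Im k ^+ 2) * dot2 x y.
Proof.
by rewrite !dot2E dotZl; case: k => a b; case: (dot x y) => c d /=; ring.
Qed.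

Lemma dot2_nsq x : dot2 x x = nsq x ^+ 2.
Proof. by rewrite dot2E dot_normE /=; ring. Qed.

(** The equality case of the Cauchy-Schwarz inequality. *)
Lemma phase x y : dot2 x y = nsq x * nsq y -> nsq x = nsq y ->
  exists k : R[i], complex.Re k ^+ 2 + complex.Im k ^+ 2 = 1 /\ x = k *: y.
Proof.
move=> d n; have [y0|y0] := eqVneq y 0.
  exists 1; split; first by rewrite /=; ring.
  by rewrite scale1r y0; apply: ip_eq0; rewrite n y0 ip0l.
have n0 := ip_gt0 y0.
pose k := dot x y * ((nsq y)^-1)%:C; exists k.
have kn : complex.Re k ^+ 2 + complex.Im k ^+ 2 = 1.
  have : dot2 x y = nsq y ^+ 2 by rewrite d n expr2.
  rewrite dot2E /k; case: (dot x y) => a b /= e.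
  have -> : (a * (nsq y)^-1 - b * 0) ^+ 2 + (a * 0 + b * (nsq y)^-1) ^+ 2 =
    (a ^+ 2 + b ^+ 2) / nsq y ^+ 2 by field; rewrite gt_eqF.
  by rewrite e divff // expf_neq0 // gt_eqF.
split=> //; apply/eqP; rewrite -subr_eq0; apply/eqP/ip_eq0.
have e1 : ip x (k *: y) = nsq y.
  have : dot2 x y = nsq y ^+ 2 by rewrite d n expr2.
  rewrite dot2E /ip dotZr /k; case: (dot x y) => a b /= e.
  by apply: (mulIf (x := nsq y)); rewrite ?gt_eqF //= -expr2 -e; field;
    rewrite gt_eqF.
have e2 : nsq (k *: y) = nsq y.
  rewrite {1}/ip dotZr dotZl dot_normE; move: kn; case: (k) => a b /= kn.
  by rewrite -[RHS]mul1r -kn; ring.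
by rewrite !ipE (ipC (k *: y)) e1 e2 n; ring.
Qed.

Lemma nsq_unitD e z : dot e e = 1 -> dot z e = 0 -> nsq (e + z) = 1 + nsq z.
Proof.
move=> e1 ze; have ez : ip e z = 0 by rewrite ipC /ip ze.
by rewrite !ipDl !ipDr (ipC z e) ez add0r addr0 {1}/ip e1.
Qed.

Lemma dot2_1D e z w : dot e e = 1 -> dot z e = 0 -> dot w e = 0 ->
  dot2 (e + z) (e + w) = 1 + 2 * ip z w + dot2 z w.
Proof.
move=> e1 ze we; rewrite !dot2E !dotE e1 ze (dotC w e) we conjC0.
by rewrite /ip; case: (dot z w) => a b /=; ring.
Qed.

(** Linear and antilinear maps are treated together, as maps that are linear up
    to [conj_if b]. *)
Definition conj_if (b : bool) (k : R[i]) : R[i] := if b then Num.conj k else k.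

Lemma conj_ifM (b : bool) k l : conj_if b (k * l) = conj_if b k * conj_if b l.
Proof. by case: b => //=; rewrite rmorphM. Qed.
Lemma conj_ifD (b : bool) k l : conj_if b (k + l) = conj_if b k + conj_if b l.
Proof. by case: b => //=; rewrite rmorphD. Qed.
Lemma conj_if_conj (b : bool) k : conj_if b (Num.conj k) =
  Num.conj (conj_if b k).
Proof. by case: b. Qed.
Lemma conj_if_norm (b : bool) k :
  complex.Re (conj_if b k) ^+ 2 + complex.Im (conj_if b k) ^+ 2 =
  complex.Re k ^+ 2 + complex.Im k ^+ 2.
Proof. by case: b; case: k => c d //=; rewrite sqrrN. Qed.

(** A map of orthogonal complements that preserves the real part and the modulus
    of inner products is real linear, and it is complex linear or antilinear. *)
Section PhaseIsometry.
Variables (e e' : H) (V : H -> H).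
Hypotheses (e1 : dot e e = 1) (e'1 : dot e' e' = 1).
Hypothesis V_orth : forall z, dot z e = 0 -> dot (V z) e' = 0.
Hypothesis V_ip : forall z w, dot z e = 0 -> dot w e = 0 ->
  ip (V z) (V w) = ip z w.
Hypothesis V_dot2 : forall z w, dot z e = 0 -> dot w e = 0 ->
  dot2 (V z) (V w) = dot2 z w.

Lemma orthD z w : dot z e = 0 -> dot w e = 0 -> dot (z + w) e = 0.
Proof. by move=> ze we; rewrite dotDl ze we addr0. Qed.

Lemma orthZ (k : R[i]) z : dot z e = 0 -> dot (k *: z) e = 0.
Proof. by move=> ze; rewrite dotZl ze mulr0. Qed.

(** [ip] of the difference with itself expands to zero. *)
Lemma VD z w : dot z e = 0 -> dot w e = 0 -> V (z + w) = V z + V w.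
Proof.
move=> ze we; have zwe := orthD ze we.
apply/eqP; rewrite -subr_eq0; apply/eqP/ip_eq0.
by rewrite !ipE !V_ip // !ipE; ring.
Qed.

Lemma VZ r z : dot z e = 0 -> V (r *r z) = r *r V z.
Proof.
move=> ze; have rze := orthZ r%:C ze.
apply/eqP; rewrite -subr_eq0; apply/eqP/ip_eq0.
by rewrite !ipE !V_ip // !ipE; ring.
Qed.

(** [V (i z)] is a multiple of [V z] by a number of modulus one, because the
    Cauchy-Schwarz inequality is an equality, and this number is imaginary,
    because [V (i z)] and [V z] have real inner product zero. *)
Lemma V_i z : dot z e = 0 ->
  V ('i *: z) = 'i *: V z \/ V ('i *: z) = - ('i *: V z).
Proof.
move=> ze; have ize := orthZ 'i ze.
have [z0|z0] := eqVneq z 0.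
  have V0 : V 0 = 0 by have := VZ 0 ze; rewrite !scale0r.
  by left; rewrite z0 scaler0 V0 scaler0.
have n0 := ip_gt0 z0.
have [||k] := @phase (V ('i *: z)) (V z).
- by rewrite V_dot2 // !V_ip // ip_ii dot2Zl dot2_nsq /=; ring.
- by rewrite !V_ip // ip_ii.
- move=> [kn Vk]; have : ip (V ('i *: z)) (V z) = 0
  by rewrite V_ip // ipC ip_i0.
  rewrite Vk /ip dotZl dot_normE V_ip // => Rek.
  have {Rek} : complex.Re k * nsq z = 0.
    by move: Rek; case: (k) => a b /=; rewrite mulr0 subr0.
  move=> /eqP; rewrite mulf_eq0 (gt_eqF n0) orbF => /eqP k0.
  move: kn; rewrite k0 expr0n add0r => /eqP; rewrite sqrf_eq1 => /orP[]/eqP ki.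
    by left; congr (_ *: _); case: (k) k0 ki => a b /= -> ->.
  right; rewrite -scaleNr; congr (_ *: _).
  by case: (k) k0 ki => a b /= -> ->; apply/eqP;
    rewrite eq_complex /= oppr0 !eqxx.
Qed.

(** The sign in [V (i z) = +- i V z] does not depend on [z], by additivity. *)
Lemma V_sign : exists b : bool, forall z, dot z e = 0 ->
  V ('i *: z) = conj_if b 'i *: V z.
Proof.
have cji : conj_if true 'i = - 'i :> R[i].
  by apply/eqP; rewrite eq_complex /= oppr0 !eqxx.
have [h|/existsNP[z]] := pselect (forall z, dot z e = 0 ->
  V ('i *: z) = 'i *: V z).
  by exists false.
move=> /not_implyP[ze zi]; exists true => w we; rewrite cji scaleNr.
have [wi|//] := V_i we.
have zi' : V ('i *: z) = - ('i *: V z) by case: (V_i ze).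
have := V_i (orthD ze we).
rewrite scalerDr !VD // ?orthZ // zi' wi scalerDr => -[h|].
  by case: zi; rewrite zi' (addIr _ h).
by rewrite opprD => /addrI.
Qed.

Section Extension.
Variable b : bool.
Hypothesis Vi : forall z, dot z e = 0 -> V ('i *: z) = conj_if b 'i *: V z.

Lemma V_cj (k : R[i]) z : dot z e = 0 -> V (k *: z) = conj_if b k *: V z.
Proof.
move=> ze; have kE : k = (complex.Re k)%:C + (complex.Im k)%:C * 'i.
  by rewrite {1}[k]complexE mulrC.
rewrite {1 2}kE scalerDl -scalerA VD ?orthZ // !VZ ?orthZ // Vi //.
rewrite conj_ifD conj_ifM scalerDl scalerA.
have conj_ifR r : conj_if b (r%:C) = r%:C by case: (b) => //=; exact: conjR.
by rewrite !conj_ifR.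
Qed.

Lemma V_dot z w : dot z e = 0 -> dot w e = 0 ->
  dot (V z) (V w) = conj_if b (dot z w).
Proof.
move=> ze we; rewrite (dot_ip (V z)) (dot_ip z) V_ip //.
have := V_ip ze (orthZ 'i we); rewrite Vi //.
case: (b) => /= [|->//].
rewrite (_ : Num.conj 'i = - 'i); last first.
  by apply/eqP; rewrite eq_complex /= oppr0 !eqxx.
by rewrite scaleNr ipNr => <-; apply/eqP; rewrite eq_complex /= opprK !eqxx.
Qed.

Definition wigner_ext x : H := conj_if b (dot x e) *: e' + V (x - dot x e *: e).

Lemma proj_orth x : dot (x - dot x e *: e) e = 0.
Proof. by rewrite !dotE e1 mulr1 subrr. Qed.

Lemma wigner_lin (k : R[i]) x y : wigner_ext (k *: x + y) = conj_if b k *: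
  wigner_ext x + wigner_ext y.
Proof.
rewrite /wigner_ext.
have -> : k *: x + y - dot (k *: x + y) e *: e =
    k *: (x - dot x e *: e) + (y - dot y e *: e).
  by rewrite dotDl dotZl scalerDl opprD addrACA scalerBr scalerA.
rewrite (VD (orthZ k (proj_orth x)) (proj_orth y)) (V_cj k (proj_orth x)).
by rewrite dotDl dotZl conj_ifD conj_ifM scalerDl scalerDr scalerA addrACA.
Qed.

Lemma wigner_dot x y : dot (wigner_ext x) (wigner_ext y) = conj_if b (dot x y).
Proof.
suff h (k l : R[i]) z w : dot z e = 0 -> dot w e = 0 ->
    dot (conj_if b k *: e' + V z) (conj_if b l *:
      e' + V w) = conj_if b (dot (k *: e + z) (l *: e + w)).
  have split v : v = dot v e *: e + (v - dot v e *: e) by rewrite addrC subrK.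
  by rewrite {2}(split x) {2}(split y) -h ?proj_orth.
move=> ze we; have ew : dot e w = 0 by rewrite dotC we conjC0.
have e'V : dot e' (V w) = 0 by rewrite dotC V_orth // conjC0.
rewrite !dotE e'1 e1 V_dot // ze ew e'V V_orth //.
by rewrite !mulr0 !addr0 !add0r !mulr1 conj_ifD conj_ifM conj_if_conj.
Qed.
End Extension.
End PhaseIsometry.

Section Wigner.
Variable g : H -> H.
Hypothesis g_dot2 : forall x y, dot2 (g x) (g y) = dot2 x y.

Lemma g_nsq x : nsq (g x) = nsq x.
Proof.
apply/eqP; rewrite -(@eqrXn2 _ 2) ?ip_ge0 // -!dot2_nsq g_dot2.
exact/eqP.
Qed.

Section Base.
Variable e : H.
Hypothesis e1 : dot e e = 1.

(** The representative of the ray of [g x] with component [1] along [g e]. *)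
Definition gnorm x : H := (dot (g x) (g e))^-1 *: g x.
(** [gnorm] maps [e + z] to [g e + V z], where [V] maps the complement of [e]
    to that of [g e]. From [|1 + <V z, V w>| = |1 + <z, w>|] and
    [|<V z, V w>| = |<z, w>|] it follows that [V] preserves real parts. *)
Definition V z : H := gnorm (e + z) - g e.

Lemma ge1 : dot (g e) (g e) = 1.
Proof.
have : nsq e = 1 by rewrite /ip e1.
by rewrite -g_nsq dot_normE => ->.
Qed.

Lemma ez1 z : dot z e = 0 -> dot (e + z) e = 1.
Proof. by move=> ze; rewrite dotDl e1 ze addr0. Qed.

Lemma gnormP x : dot x e = 1 ->
  dot (gnorm x) (g e) = 1 /\ forall y, dot2 (gnorm x) (g y) = dot2 x y.
Proof.
move=> xe; have : dot2 (g x) (g e) = 1 by rewrite g_dot2 dot2E xe /=; ring.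
rewrite dot2E /gnorm => n1.
have n0 : dot (g x) (g e) != 0.
  by apply/eqP => n0; move: n1; rewrite n0 /= expr0n addr0 => /eqP;
    rewrite eq_sym oner_eq0.
split=> [|y]; first by rewrite dotZl mulVf.
rewrite dot2Zl g_dot2; suff -> : forall k : R[i],
    complex.Re k ^+ 2 + complex.Im k ^+ 2 = 1 ->
    complex.Re k^-1 ^+ 2 + complex.Im k^-1 ^+ 2 = 1 by rewrite ?mul1r.
move=> [a b] /= kn; rewrite kn !divr1 sqrrN.
exact: kn.
Qed.

Lemma V_orth z : dot z e = 0 -> dot (V z) (g e) = 0.
Proof.
move=> /ez1/gnormP[h _]; by rewrite /V dotDl dotNl h ge1 subrr.
Qed.

Lemma gnormE z : gnorm (e + z) = g e + V z.
Proof. by rewrite /V [RHS]addrC subrK. Qed.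

Lemma gnorm_scale x : dot x e = 1 -> exists k : R[i],
  complex.Re k ^+ 2 + complex.Im k ^+ 2 = 1 /\ gnorm x = k *: g x.
Proof.
move=> xe; exists (dot (g x) (g e))^-1; split=> //.
have [_ /(_ x)] := gnormP xe; rewrite /gnorm dot2Zl g_dot2.
have : dot2 x x != 0.
  rewrite dot2_nsq sqrf_eq0; apply/eqP => /ip_eq0 x0.
  by move: xe; rewrite x0 linear0l => /eqP; rewrite eq_sym oner_eq0.
by move=> n0 /(canRL (mulfK n0)); rewrite divff.
Qed.

Lemma gnorm_dot2 x y : dot x e = 1 -> dot y e = 1 ->
  dot2 (gnorm x) (gnorm y) = dot2 x y.
Proof.
move=> xe ye; have [k [k1 ->]] := gnorm_scale ye.
by rewrite dot2C dot2Zl k1 mul1r dot2C; have [_ ->] := gnormP xe.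
Qed.

Lemma V_nsq z : dot z e = 0 -> nsq (V z) = nsq z.
Proof.
move=> ze; have := gnorm_dot2 (ez1 ze) (ez1 ze).
rewrite !dot2_nsq => /eqP; rewrite eqrXn2 ?ip_ge0 // gnormE => /eqP.
by rewrite (nsq_unitD e1 ze) (nsq_unitD ge1 (V_orth ze)) => /addrI.
Qed.

(** [V z] lies on the ray of [g z]: as [g z] is orthogonal to [g e], its inner
    product with [V z] is that with [gnorm (e + z)], of modulus [|z|^2]. *)
Lemma V_scale z : dot z e = 0 -> exists k : R[i],
  complex.Re k ^+ 2 + complex.Im k ^+ 2 = 1 /\ V z = k *: g z.
Proof.
move=> ze; apply: phase; last by rewrite V_nsq // g_nsq.
rewrite V_nsq // g_nsq -expr2 -dot2_nsq.
have ez : dot e z = 0 by rewrite dotC ze conjC0.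
have gez : dot (g e) (g z) = 0.
  by apply: dot2_eq0; rewrite g_dot2 dot2E ez /=; ring.
have [_ /(_ z)] := gnormP (ez1 ze); rewrite gnormE !dot2E !dotDl gez ez !add0r.
by [].
Qed.

Lemma V_dot2 z w : dot z e = 0 -> dot w e = 0 -> dot2 (V z) (V w) = dot2 z w.
Proof.
move=> /V_scale[k [k1 ->]] /V_scale[l [l1 ->]].
by rewrite dot2Zl k1 dot2C dot2Zl l1 dot2C g_dot2 !mul1r.
Qed.

Lemma V_ip z w : dot z e = 0 -> dot w e = 0 -> ip (V z) (V w) = ip z w.
Proof.
move=> ze we; have := gnorm_dot2 (ez1 ze) (ez1 we).
rewrite !gnormE (dot2_1D e1 ze we) (dot2_1D ge1 (V_orth ze) (V_orth we)).
by rewrite V_dot2 //; lra.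
Qed.

Section Ray.
Variable b : bool.
Hypothesis Vi : forall z, dot z e = 0 -> V ('i *: z) = conj_if b 'i *: V z.

Local Notation U := (wigner_ext e (g e) V b).

(** If [a] is the component of [x] along [e] and is nonzero, [x] is a multiple of
    [e + z] with [z] orthogonal to [e], and [U x] is the corresponding multiple of
    [gnorm (e + z)]. Otherwise [U x] is [V x]. *)
Lemma wigner_ray x : exists k : R[i], g x = k *: U x.
Proof.
have nU : nsq (U x) = nsq x.
  by rewrite /ip (wigner_dot e1 ge1 V_orth V_ip Vi); case: (b) => //=;
    case: (dot x x).
suff d : dot2 (g x) (U x) = nsq x * nsq x.
  by have [|//|k [_ ->]] := @phase (g x) (U x); rewrite ?g_nsq ?nU //; exists k.
have [x0|x0] := eqVneq (dot x e) 0.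
  have UE : U x = V x.
    rewrite /U x0 scale0r subr0 (_ : conj_if b 0 = 0) ?scale0r ?add0r //.
    by case: (b) => //=; rewrite conjC0.
  have [k [k1 Vk]] := V_scale x0; rewrite UE Vk dot2C dot2Zl k1 mul1r.
  by rewrite g_dot2 dot2_nsq.
set a := dot x e in x0.
pose z := a^-1 *: (x - a *: e).
have ze : dot z e = 0 by rewrite orthZ // (proj_orth e1).
have xE : x = a *: (e + z).
  by rewrite scalerDr /z scalerA mulfV // scale1r addrC subrK.
have UE : U x = conj_if b a *: gnorm (e + z).
  rewrite gnormE scalerDr -(V_cj V_ip Vi) // /wigner_ext -/a; congr (_ + V _).
  by rewrite /z scalerA mulfV // scale1r.
rewrite UE dot2C dot2Zl conj_if_norm; have [_ ->] := gnormP (ez1 ze).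
by rewrite -dot2Zl -xE dot2_nsq expr2.
Qed.
End Ray.
End Base.

(** [U] is [V] on the complement of a unit vector [e], extended by [U e = g e]. *)
Lemma wigner : exists (b : bool) (U : H -> H),
  [/\ forall (k : R[i]) x y, U (k *: x + y) = conj_if b k *: U x + U y,
      forall x y, dot (U x) (U y) = conj_if b (dot x y) &
      forall x, exists k : R[i], g x = k *: U x].
Proof.
have [H0|/existsNP[p /eqP/unit_scale[e e1 _]]] := pselect (forall x, x = 0).
  by exists false, id; split=> // x; exists 0; rewrite (H0 (g x)) scale0r.
have {}e1 : dot e e = 1 by rewrite dot_normE e1.
have [b Vb] := V_sign (V_ip e1) (V_dot2 e1).
exists b, (wigner_ext e (g e) (V e) b); split.
- exact: (wigner_lin (g e) e1 (V_ip e1) Vb).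
- exact: (wigner_dot e1 (ge1 e1) (V_orth e1) (V_ip e1) Vb).
- exact: (wigner_ray e1 Vb).
Qed.
End Wigner.

(** * Conjugation by a unitary or antiunitary operator *)

Lemma quadZ A (k : R[i]) x : linear A ->
  ip (A (k *: x)) (k *: x) =
    (complex.Re k ^+ 2 + complex.Im k ^+ 2) * ip (A x) x.
Proof.
move=> lA; rewrite (linZ lA) /ip dotZl dotZr.
by case: k => a b; case: (dot (A x) x) => c d /=; ring.
Qed.

Lemma symm_quad0 A : linear A -> symm A -> (forall x, ip (A x) x = 0) ->
  forall x, A x = 0.
Proof.
move=> lA sA A0 x; apply: ip_eq0; have := A0 (x + A x).
by rewrite (linD lA) !ipE !A0 (sA (A x)); lra.
Qed.

Lemma conj_ifK (b : bool) : involutive (conj_if b).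
Proof. by case: b => // k; exact: conjCK. Qed.

Lemma conj_ifR (b : bool) r : conj_if b (r%:C) = r%:C.
Proof. by case: b => //=; exact: conjR. Qed.

Section SemilinearIsometry.
Variables (b : bool) (U V : H -> H).
Hypothesis U_lin : forall (k : R[i]) x y, U (k *: x + y) = conj_if b k *:
  U x + U y.
Hypothesis U_dot : forall x y, dot (U x) (U y) = conj_if b (dot x y).

Lemma U0 : U 0 = 0.
Proof. by apply: dot_eq0; rewrite U_dot linear0l; case: (b) => //=;
  exact: conjC0. Qed.

Lemma UZ (k : R[i]) x : U (k *: x) = conj_if b k *: U x.
Proof. by have := U_lin k x 0; rewrite U0 !addr0. Qed.

Lemma U_ip x y : ip (U x) (U y) = ip x y.
Proof. by rewrite /ip U_dot; case: (b) => //=; case: (dot x y). Qed.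

Lemma U_inj : injective U.
Proof.
move=> x y Uxy; apply/eqP; rewrite -subr_eq0; apply/eqP/ip_eq0.
have cN1 : conj_if b (-1) = -1 by case: (b) => //=; rewrite rmorphN1.
by rewrite -U_ip -scaleN1r addrC U_lin Uxy cN1 scaleN1r addNr ip0l.
Qed.

Hypothesis VK : forall y, U (V y) = y.

Lemma V_lin (k : R[i]) x y : V (k *: x + y) = conj_if b k *: V x + V y.
Proof. by apply: U_inj; rewrite U_lin !VK conj_ifK. Qed.

Lemma conj_linear A : linear A -> linear (U \o A \o V).
Proof. by move=> lA k x y /=; rewrite V_lin lA U_lin conj_ifK. Qed.

Lemma conj_symm A : symm A -> symm (U \o A \o V).
Proof.
by move=> sA x y /=; rewrite -{1}(VK y) -{2}(VK x) !U_ip sA.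
Qed.
End SemilinearIsometry.

Lemma isometry_conjugation (phi : (H -> H) -> (H -> H)) :
  set_bij (trace_class_pos dot) (trace_class_pos dot) phi ->
  (forall A B, trace_class_pos dot A -> trace_class_pos dot B ->
    d1 dot (phi A) (phi B) = d1 dot A B) ->
  exists U : H -> H, (unitary dot U \/ antiunitary dot U) /\
    forall A, trace_class_pos dot A -> phi A = U \o A \o ustar U.
Proof.
move=> [phi_fun phi_inj phi_surj] phi_isom.
have phi_tcpos A : tcpos A -> tcpos (phi A) by move=> /tcposP/phi_fun/tcposP.
have phi_tdist A B : tcpos A -> tcpos B -> tdist (phi A) (phi B) = tdist A B.
  by move=> /tcposP tA /tcposP tB; rewrite /tdist phi_isom.
have /choice[psi psiP] : forall B, exists A, tcpos B -> tcpos A /\ phi A = B.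
  move=> B; have [tB|tB] := pselect (tcpos B); last by exists B.
  by have [A /tcposP tA AB] := phi_surj B (proj2 (tcposP B) tB); exists A.
have psi_tcpos B : tcpos B -> tcpos (psi B) by move=> /psiP[].
have psiK B : tcpos B -> phi (psi B) = B by move=> /psiP[].
have phiK A : tcpos A -> psi (phi A) = A.
  move=> tA; apply: phi_inj; rewrite ?inE ?psiK //; try exact/phi_tcpos.
    exact/tcposP/psi_tcpos/phi_tcpos.
  exact/tcposP.
have psi_tdist A B : tcpos A -> tcpos B -> tdist (psi A) (psi B) = tdist A B.
  by move=> tA tB; rewrite -phi_tdist ?psiK //; exact: psi_tcpos.
have /choice[g gP] := phi_rank1 phi_tcpos psi_tcpos psiK phi_tdist.
have g_dot2 x y : dot2 (g x) (g y) = dot2 x y.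
  exact: (phi_dot2 phi_tcpos psi_tcpos psiK phi_tdist).
have [b [U [U_lin U_dot gU]]] := wigner g_dot2.
have U_surj y : exists x, U x = y.
  have [x xy] := phi_rank1 psi_tcpos phi_tcpos phiK psi_tdist y.
  have /rank1_eqP[k yk] : forall z, rank1 y z = rank1 (g x) z.
    by move=> z; rewrite -gP -xy psiK //; exact: tcpos_rank1.
  have [l gl] := gU x; exists (conj_if b (k * l) *: x).
  by rewrite (UZ U_lin U_dot) conj_ifK yk gl scalerA.
have Uinj := U_inj U_lin U_dot.
have Ubij : bijective U.
  by have /choice[V VK] := U_surj; exists V => // x; apply: Uinj; rewrite VK.
have [UK VK] := ustarK Ubij.
exists U; split.
  case: b {gU} U_lin U_dot Uinj => U_lin U_dot Uinj; [right|left]; by split.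
move=> A /tcposP tA; set V := ustar U in UK VK *.
have [lA sA] := (psd_lin (tcpos_psd tA), psd_symm (tcpos_psd tA)).
have tpA := phi_tcpos _ tA.
have [lpA spA] := (psd_lin (tcpos_psd tpA), psd_symm (tcpos_psd tpA)).
pose D := phi A \- (U \o A \o V).
have lD : linear D by apply: linearB_op => //; exact: (conj_linear U_lin U_dot).
have sD : symm D.
  by move=> x y; rewrite /D /= !ipE spA (conj_symm U_dot VK sA).
(* [g u] and [U u] are unit vectors of the same ray, so that the forms agree. *)
have unit_case (u : H) : nsq u = 1 -> ip (D (U u)) (U u) = 0.
  move=> u1; rewrite /D /= ipDl ipNl UK (U_ip U_dot).
  have := phi_quad phi_tcpos psi_tcpos psiK phi_tdist tA u1 (gP u).
  have g1 : nsq (g u) = 1 by rewrite (g_nsq g_dot2).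
  have [k gk] := gU u; rewrite gk in g1 *.
  move: g1; rewrite (quadZ (A := id)) // (U_ip U_dot) u1 mulr1 => k1.
  by rewrite quadZ // k1 mul1r => ->; rewrite subrr.
have D0 y : ip (D y) y = 0.
  rewrite -(VK y); have [->|/unit_scale[u u1 ->]] := eqVneq (V y) 0.
    by rewrite (U0 U_dot) ip0r.
  by rewrite (UZ U_lin U_dot) conj_ifR quadZ // unit_case // mulr0.
apply/funext => y; apply/eqP; rewrite -subr_eq0; apply/eqP.
exact: symm_quad0 lD sD D0 y.
Qed.

End Proof.

Theorem theorem3 (R : realType) (H : completeNormedModType R[i])
    (dot : {dot H for Num.conj})
    (dot_norm : forall x : H, `|x| ^+ 2 = dot x x)
    (phi : (H -> H) -> (H -> H))
    (phi_bij : set_bij (trace_class_pos dot) (trace_class_pos dot) phi)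
    (phi_isom : forall A B : H -> H, trace_class_pos dot A ->
      trace_class_pos dot B -> d1 dot (phi A) (phi B) = d1 dot A B) :
  exists U : H -> H, (unitary dot U \/ antiunitary dot U) /\
    forall A : H -> H, trace_class_pos dot A -> phi A = U \o A \o ustar U.
Proof. exact: (isometry_conjugation dot_norm phi_bij phi_isom). Qed.
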